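(* Consider the instrumental-variables model described in the context, with $\pi_1\neq 0$, under Assumption A. Let $(\lambda_n)$ satisfy $\lambda_n=o(\sqrt n)$. Then the ridge IV estimator \[ \hat\beta_{\text{ridge}} = \frac{\sum_{i=1}^n (Y_i-\bar Y)(Z_i-\bar Z)}{\sum_{i=1}^n (D_i-\bar D)(Z_i-\bar Z) + \lambda_n} \] is asymptotically normal: \[ \sqrt n\left(\hat\beta_{\text{ridge}}-\beta_1\right) \xrightarrow{d} \mathcal N\!\left(0,\ \frac{\sigma_\epsilon^2}{\pi_1^2}\right). \]
   Context: Data model: for each sample size $n$, observations $(Y_i,D_i,Z_i)$, $i=1,\dots,n$, satisfy $Y_i=\beta_0+\beta_1 D_i+\epsilon_i$ and $D_i=\pi_0+\pi_1 Z_i+\eta_i$, where the error pairs $(\epsilon_i,\eta_i)$ are i.i.d. across $i$ with mean zero, $\mathrm{Var}(\epsilon_i)=\sigma_\epsilon^2<\infty$, $\mathrm{Var}(\eta_i)=\sigma_\eta^2<\infty$ and $\mathrm{Cov}(\epsilon_i,\eta_i)=\sigma_{\epsilon\eta}$ (the errors may be correlated), and the instruments are independent of the errors. Bars denote sample means. The penalty $\lambda_n$ is a deterministic sequence of nonnegative reals. Assumption A (instruments as constants): the analysis is conditional on the instruments, so $Z_1,Z_2,\dots$ is a deterministic real sequence, with $\frac1n\sum_{i=1}^n Z_i^2\to 1$ and $\frac1n\sum_{i=1}^n Z_i \to 0$. *)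

(* Defs.v *)
From HB Require Import structures.
From mathcomp Require Import all_boot all_order all_algebra.
From mathcomp Require Import all_classical all_reals all_analysis.
Set Implicit Arguments. Unset Strict Implicit. Unset Printing Implicit Defensive.
Import Order.TTheory GRing.Theory Num.Theory.
Import numFieldNormedType.Exports.
Local Open Scope classical_set_scope.
Local Open Scope ring_scope.

(** Sample mean of the first n terms f 0, ..., f (n-1)
    (observations are indexed 0..n-1 instead of 1..n). *)
Definition smean {R : realType} (n : nat) (f : nat -> R) : R :=
  (\sum_(i < n) f i) / n%:R.

(** The ridge IV estimator computed from the first n observations,
    with penalty lam. (Real division: x / 0 = 0 in MathComp.) *)
Definition beta_ridge {R : realType} (n : nat) (lam : R)
    (Y D Z : nat -> R) : R :=
  (\sum_(i < n) (Y i - smean n Y) * (Z i - smean n Z)) /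
  (\sum_(i < n) (D i - smean n D) * (Z i - smean n Z) + lam).

Definition mutually_independent_pairs {d} {T : measurableType d}
    {R : realType} (P : probability T R) (X : nat -> T -> R * R) : Prop :=
  forall (J : seq nat) (A : nat -> set (R * R)),
    uniq J -> (forall i, i \in J -> measurable (A i)) ->
    P [set w | forall i, i \in J -> A i (X i w)] =
    (\big[*%E/1%E]_(i <- J) P (X i @^-1` A i))%E.

Definition identically_distributed_pairs {d} {T : measurableType d}
    {R : realType} (P : probability T R) (X : nat -> T -> R * R) : Prop :=
  forall (i : nat) (A : set (R * R)), measurable A ->
    P (X i @^-1` A) = P (X 0%N @^-1` A).

Definition normal_cdf {R : realType} (v : R) (x : R) : R :=
  if v == 0 then (if 0 <= x then 1 else 0)
  else fine (normal_prob 0 (Num.sqrt v) `]-oo, x]).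

Definition cvg_in_distribution {d} {T : measurableType d} {R : realType}
    (P : probability T R) (X : nat -> T -> R) (F : R -> R) : Prop :=
  forall x : R, {for x, continuous F} ->
    (fun n => fine (P [set w | X n w <= x])) @ \oo --> F x.

(* Main.v *)
(** Lindeberg's replacement argument in Trotter's operator form.  For a random
    variable [X] let [average P X f x] be the expectation of [f (x + X)].  If [f]
    is smooth, the averages over [X] and over a centered Gaussian of the same
    variance agree up to [E (X^2 min(1, |X|))] uniformly in [x]; independence
    turns the law of a sum into a composition of averages and the Gaussian
    averages form a semigroup, so the errors add up.  For the weighted sums
    [sum c_(n,i) e_i] with [max |c_(n,i)| -> 0] and [sum c_(n,i)^2 -> v] the total
    error vanishes by dominated convergence.  Logistic step functions then give
    bounds on distribution functions, and the ridge estimator is handled by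
    Slutsky: its scaled error is at most [x] iff a weighted sum of the [eps_i] is
    at most [x + o_P(1)], with weights [(Z_i - mean Z) / (sqrt n pi1)]. *)

Require Import Defs.
From HB Require Import structures.
From mathcomp Require Import all_boot all_order all_algebra.
From mathcomp Require Import all_classical all_reals all_analysis.
From mathcomp Require Import measurable_realfun ring lra.
Set Implicit Arguments. Unset Strict Implicit. Unset Printing Implicit Defensive.
Import Order.TTheory GRing.Theory Num.Theory.
Import numFieldNormedType.Exports.
Local Open Scope classical_set_scope.
Local Open Scope ring_scope.

(** The instruments enter as non-identical constants, so the limit theorem is needed for triangular
    arrays of weights. Their negligibility is not assumed: convergence of the mean of the [Z i ^+ 2]
    forces the single term [Z n ^+ 2 / n.+1%:R] to vanish, and this gives the bound on the largest
    weight. Test functions are kept non-negative so that Tonelli applies without integrability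
    conditions. Gaussians appear as a scale [a] acting on a standard normal variable, which includes
    variance zero; this degenerate case is what makes the noise in the denominator negligible. Once
    [beta1] is subtracted, the penalty leaves a bias [beta1 * lambda n / (sqrt n * pi1)] in the
    numerator and [lambda n / (n * pi1)] in the normalised denominator; the bias is what calls for
    the rate [o(sqrt n)]. Correlation between [eps] and [eta] is harmless: [eta] is confined to an
    exceptional event whose probability is simply added, so the joint law of the two weighted sums
    is never computed. *)

Section gaussian.
Context {R : realType}.
Notation mu := (@lebesgue_measure R).
Notation gauss := (@normal_prob R 0 1).

(** The image of Lebesgue measure under [x |-> a * x + b], multiplied by [a], has the right value on
    half-open intervals, hence is Lebesgue measure; the formula is then integration against an image
    measure. *)
Lemma ge0_integral_affine (f : R -> \bar R) (a b : R) : 0 < a ->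
  measurable_fun [set: R] f -> (forall x, 0 <= f x)%E ->
  (\int[mu]_x f (a * x + b)%R = a^-1%:E * \int[mu]_x f x)%E.
Proof.
move=> a0 mf f0.
have a1 : 0 <= a^-1 by rewrite invr_ge0 ltW.
pose phi (x : measurableTypeR R) : measurableTypeR R := a * x + b.
have mphi : measurable_fun setT phi.
  by apply: measurable_funD => //; exact: measurable_funM.
pose r := NngNum (ltW a0).
pose nu0 := mscale r (pushforward mu phi).
pose nu : {measure set (measurableTypeR R) -> \bar R} := nu0 mphi.
have muE A : measurable A -> mu A = nu A.
  apply: lebesgue_measure_unique => _ [[u v]] _ <- /=.
  rewrite /nu /mscale /= /pushforward.
  have -> : phi @^-1` [set` `]u, v]] = [set` `](u - b) / a, (v - b) / a]].
    apply/seteqP; split => x /=; rewrite !in_itv /= /phi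
      ltr_pdivrMr// ler_pdivlMr// ltrBlDr lerBrDr (mulrC x) //.
  rewrite !lebesgue_measure_itv /= !lte_fin ltr_pM2r ?invr_gt0// ltrD2r.
  case: ifPn => _; last by rewrite mule0.
  by rewrite -EFinB -EFinM; congr EFin; field; rewrite gt_eqF.
rewrite [X in _ = (_ * X)%E](eq_measure_integral nu); last by move=> A mA _; exact: muE.
rewrite ge0_integral_mscale//= ge0_integral_pushforward//= preimage_setT.
by rewrite muleA -EFinM mulVf ?mul1e// gt_eqF.
Qed.

(** The Radon-Nikodym derivative of the Gaussian law and [normal_pdf] have the same integral over
    every measurable set, so they agree almost everywhere. *)
Lemma integral_gauss (f : R -> \bar R) : measurable_fun [set: R] f ->
  (forall x, 0 <= f x)%E ->
  (\int[gauss]_x f x = \int[mu]_x (f x * (normal_pdf 0 1 x)%:E))%E.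
Proof.
move=> mf f0.
have dom := @normal_prob_dominates R 0 1.
rewrite -(Radon_Nikodym_SigmaFinite.change_of_variables dom) //.
apply: ae_eq_integral => //=.
- apply: emeasurable_funM => //.
  exact: measurable_int (Radon_Nikodym_SigmaFinite.f_integrable dom).
- by apply: emeasurable_funM => //; apply/measurable_EFinP; exact: measurable_normal_pdf.
- apply: ae_eqe_mul2l.
  apply: integral_ae_eq => //.
  + exact: Radon_Nikodym_SigmaFinite.f_integrable.
  + by apply/measurable_EFinP; exact: measurable_normal_pdf.
  + by move=> E ET mE; rewrite -Radon_Nikodym_SigmaFinite.f_integral.
Qed.

End gaussian.

(** * Convolution and scaling of Gaussian laws *)

Section gaussian_convolution.
Context {R : realType}.
Notation mu := (@lebesgue_measure R).
Notation gauss := (@normal_prob R 0 1).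
Notation phi := (@normal_pdf R 0 1).

Lemma std_normal_pdfE (x : R) : phi x = normal_peak 1 * expR (- x ^+ 2 / 2).
Proof.
rewrite normal_pdfE ?oner_eq0// /normal_fun subr0 expr1n.
by congr (_ * expR (_ / _)); rewrite -mulr_natr mul1r.
Qed.

Lemma measurable_std_normal_pdf : measurable_fun [set: R] phi.
Proof. exact: measurable_normal_pdf. Qed.

Lemma normal_pdf_scale (s x : R) : 0 < s ->
  normal_pdf 0 s x = s^-1 * phi (x / s).
Proof.
move=> s0; rewrite std_normal_pdfE normal_pdfE ?gt_eqF// /normal_fun subr0.
rewrite mulrA; congr (_ * expR _).
  rewrite /normal_peak expr1n mul1r -mulrnAr sqrtrM ?sqr_ge0// invfM.
  by rewrite sqrtr_sqr gtr0_norm.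
by rewrite -[_ *+ 2]mulr_natr; field; rewrite gt_eqF.
Qed.

(** Completing the square in [y]: the first factor on the right is free of [y], and the second is
    [phi] after an affine change of [y], so the product can be integrated in [y]. *)
Lemma gauss_convolution_kernel (a b y w : R) : 0 < a -> 0 < b ->
  let c := Num.sqrt (a ^+ 2 + b ^+ 2) in
  phi ((w - a * y) / b) * phi y =
  phi (w / c) * phi (c / b * y + - (a * w / (b * c))).
Proof.
move=> a0 b0 c.
have c0 : 0 < c by rewrite sqrtr_gt0 addr_gt0// exprn_gt0.
have c2 : c ^+ 2 = a ^+ 2 + b ^+ 2 by rewrite sqr_sqrtr// addr_ge0// sqr_ge0.
rewrite !std_normal_pdfE [LHS]mulrACA [RHS]mulrACA -!expRD; congr (_ * expR _).
rewrite -!mulrDl; congr (_ / _); rewrite -!opprD; congr (- _).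
have -> : (w / c) ^+ 2 = w ^+ 2 / c ^+ 2 by rewrite expr_div_n.
have -> : (c / b * y - a * w / (b * c)) ^+ 2 =
    c ^+ 2 * y ^+ 2 / b ^+ 2 - 2 * a * w * y / b ^+ 2
    + a ^+ 2 * w ^+ 2 / (b ^+ 2 * c ^+ 2).
  by field; rewrite !gt_eqF.
have c20 : a ^+ 2 + b ^+ 2 != 0 by rewrite -c2 gt_eqF// exprn_gt0.
by rewrite c2; field; rewrite !gt_eqF// addr_gt0// exprn_gt0.
Qed.

(** Substituting [w = a * y + b * z] in the inner integral and exchanging the integrals leaves the
    completed square to integrate in [y]. The substitution divides by [b] and the result by [c], so
    [a = 0] and [b = 0] are settled first. *)
Lemma gauss_semigroup (f : R -> \bar R) (a b : R) : 0 <= a -> 0 <= b ->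
  measurable_fun [set: R] f -> (forall x, 0 <= f x)%E ->
  (\int[gauss]_y \int[gauss]_z f (a * y + b * z)%R =
   \int[gauss]_y f (Num.sqrt (a ^+ 2 + b ^+ 2) * y)%R)%E.
Proof.
move=> a0 b0 mf f0.
have ga1 (k : \bar R) : (\int[gauss]_y k = k)%E.
  rewrite (_ : (fun=> k) = cst k)// integral_cst//= probability_setT mule1//.
move: a0; rewrite le_eqVlt => /predU1P[<-|a0].
  rewrite expr0n/= add0r sqrtr_sqr ger0_norm// -[RHS]ga1.
  apply: eq_integral => y _; apply: eq_integral => z _.
  by rewrite mul0r add0r.
move: b0; rewrite le_eqVlt => /predU1P[<-|b0].
  rewrite expr0n/= addr0 sqrtr_sqr gtr0_norm//.
  apply: eq_integral => y _; rewrite -[RHS]ga1.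
  by apply: eq_integral => z _; rewrite mul0r addr0.
set c := Num.sqrt _.
have c0 : 0 < c by rewrite sqrtr_gt0 addr_gt0// exprn_gt0.
have mphi := measurable_std_normal_pdf.
have phi0 x : 0 <= phi x := normal_pdf_ge0 _ _ _.
have mlin (k l : R) : measurable_fun [set: R] (fun x : R => k * x + l).
  by apply: measurable_funD => //; exact: measurable_funM.
(* [h] is the integrand in the variables [(y, w)]; the factor [b^-1] is the Jacobian of
   [z |-> w]. *)
pose h (p : R * R) := (f p.2 * (b^-1 * (phi ((p.2 - a * p.1) / b) * phi p.1))%:E)%E.
have mh : measurable_fun [set: R * R] h.
  apply: emeasurable_funM; first exact: measurableT_comp.
  apply/measurable_EFinP; apply: measurable_funM => //.
  apply: measurable_funM; last exact: measurableT_comp.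
  apply: measurableT_comp => //; apply: measurable_funM => //.
  by apply: measurable_funB => //; exact: measurable_funM.
have h0 p : (0 <= h p)%E.
  by rewrite mule_ge0// lee_fin !mulr_ge0// invr_ge0 ltW.
transitivity (\int[mu]_y \int[mu]_w h (y, w))%E.
  have inE (y : R) : (\int[gauss]_z f (a * y + b * z)%R * (phi y)%:E =
      \int[mu]_w h (y, w))%E.
    rewrite integral_gauss//; last first.
      by apply: measurableT_comp => //; under eq_fun do rewrite addrC; exact: mlin.
    pose F w := (f w * (phi ((w - a * y) / b))%:E)%E.
    have mF : measurable_fun [set: R] F.
      apply: emeasurable_funM => //; apply/measurable_EFinP.
      apply: measurableT_comp => //; apply: measurable_funM => //.
      exact: measurable_funB.
    have F0 x : (0 <= F x)%E by rewrite mule_ge0// lee_fin.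
    under eq_integral => z _.
      rewrite (_ : _ * _ = F (b * z + a * y)%R)%E; last first.
        rewrite /F addrC; congr (_ * (phi _)%:E)%E.
        by field; rewrite gt_eqF.
      over.
    rewrite (ge0_integral_affine _ b0)// -ge0_integralZl//; last first.
      by rewrite lee_fin invr_ge0 ltW.
    rewrite -ge0_integralZr//; last 3 first.
    - exact: emeasurable_funM.
    - by move=> x _; rewrite mule_ge0// lee_fin invr_ge0 ltW.
    - by rewrite lee_fin.
    apply: eq_integral => w _; rewrite /F /h /=.
    by rewrite !EFinM muleCA -!muleA.
  rewrite integral_gauss//.
  - by apply: eq_integral => y _; exact: inE.
  - have m2 : measurable_fun [set: R * R] (fun p : R * R => f (a * p.1 + b * p.2)).
      apply: measurableT_comp => //; apply: measurable_funD => //;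
      exact: measurable_funM.
    have := @measurable_fun_fubini_tonelli_F _ _ _ _ _ gauss _ m2.
    by apply => // p.
  - by move=> y; apply: integral_ge0.
transitivity (\int[mu]_w \int[mu]_y h (y, w))%E.
  exact: (@fubini_tonelli _ _ _ _ _ mu mu h mh h0).
rewrite integral_gauss//; last by apply: measurableT_comp => //; exact: measurable_funM.
pose G w := (f w * (phi (w / c))%:E)%E.
have mG : measurable_fun [set: R] G.
  apply: emeasurable_funM => //; apply/measurable_EFinP.
  by apply: measurableT_comp => //; exact: measurable_funM.
have G0 x : (0 <= G x)%E by rewrite mule_ge0// lee_fin.
under [RHS]eq_integral => y _.
  rewrite (_ : _ * _ = G (c * y + 0)%R)%E; last first.
    rewrite /G addr0; congr (_ * (phi _)%:E)%E.
    by field; rewrite gt_eqF.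
  over.
rewrite (ge0_integral_affine _ c0)// -ge0_integralZl//; last first.
  by rewrite lee_fin invr_ge0 ltW.
apply: eq_integral => w _.
rewrite /h /= ge0_integralZl//; last first.
- by move=> y _; rewrite lee_fin !mulr_ge0// invr_ge0 ltW.
- apply/measurable_EFinP; apply: measurable_funM => //.
  apply: measurable_funM => //.
  apply: measurableT_comp => //; apply: measurable_funM => //.
  by apply: measurable_funB => //; exact: measurable_funM.
rewrite /G muleCA; congr (_ * _)%E.
under eq_integral => y _.
  rewrite gauss_convolution_kernel// mulrA EFinM; over.
rewrite /= -/c ge0_integralZl//; last 3 first.
- by apply/measurable_EFinP; apply: measurableT_comp => //; exact: mlin.
- by move=> y _; rewrite lee_fin.
- by rewrite lee_fin mulr_ge0// invr_ge0 ltW.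
have mE : measurable_fun [set: R] (EFin \o phi) by exact/measurable_EFinP.
have E0 y : (0 <= (EFin \o phi) y)%E by rewrite lee_fin.
(* The Jacobian [(c / b)^-1] combines with [b^-1] into [c^-1], the Jacobian produced on the other
   side by [w = c * y]. *)
rewrite (ge0_integral_affine _ (divr_gt0 c0 b0) mE E0).
rewrite integral_normal_pdf mule1 -!EFinM; congr EFin.
by field; rewrite !gt_eqF.
Qed.

(** Connects the law used in [normal_cdf] with the scaled standard normal variable used in all
    Gaussian averages. *)
Lemma normal_prob_ray (s x : R) : 0 < s ->
  normal_prob 0 s `]-oo, x] = gauss [set y | s * y <= x].
Proof.
move=> s0.
have -> : [set y | s * y <= x] = [set` `]-oo, x / s]].
  by apply/seteqP; split => y /=; rewrite in_itv /= ler_pdivlMr// mulrC.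
rewrite /normal_prob.
have mphi := measurable_std_normal_pdf.
have phi0 y : 0 <= phi y := normal_pdf_ge0 _ _ _.
pose F (y : R) := ((phi y)%:E * (\1_`]-oo, x / s] y)%:E)%E.
have mF : measurable_fun [set: R] F.
  by apply: emeasurable_funM; apply/measurable_EFinP => //.
have F0 y : (0 <= F y)%E by rewrite mule_ge0// lee_fin.
rewrite [LHS]integral_mkcond [RHS]integral_mkcond.
transitivity (\int[mu]_y (s^-1%:E * F (s^-1 * y + 0)%R))%E.
  apply: eq_integral => y _; rewrite /F addr0 patchE indicE /=.
  have -> : (y \in `]-oo, x]%classic) = (s^-1 * y \in `]-oo, x / s]%classic).
    by apply/idP/idP; rewrite !inE /= !in_itv /= mulrC ler_pM2r ?invr_gt0.
  case: ifPn => _; last by rewrite mule0 mule0.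
  by rewrite mule1 normal_pdf_scale// (mulrC y) EFinM.
have s1 : 0 < s^-1 by rewrite invr_gt0.
have mF1 : measurable_fun [set: R] (fun y => F (s^-1 * y + 0)).
  apply: (measurableT_comp mF); apply: measurable_funD => //.
rewrite ge0_integralZl// ?lee_fin ?ltW//.
rewrite ge0_integral_affine// muleA -EFinM divff ?invr_neq0 ?gt_eqF// mul1e.
apply: eq_integral => y _; rewrite /F patchE indicE.
by case: ifPn => _; rewrite ?mule1 ?mule0.
Qed.

End gaussian_convolution.

(** * Second moment and symmetry of the standard Gaussian *)

Section gaussian_moments.
Context {R : realType}.
Notation mu := (@lebesgue_measure R).
Notation gauss := (@normal_prob R 0 1).
Notation phi := (@normal_pdf R 0 1).

Lemma is_derive_id_mul_std_normal_pdf (y : R) :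
  is_derive y 1 (fun x => x * phi x) ((1 - y ^+ 2) * phi y).
Proof.
have -> : (fun x => x * phi x) =
    (fun x : R => normal_peak 1 * (x * expR (- (x ^+ 2 * 2^-1)))).
  by apply/funext => x; rewrite std_normal_pdfE mulrCA mulNr.
rewrite std_normal_pdfE.
have d1 : is_derive y 1 (fun x : R => - (x ^+ 2 * 2^-1)) (- y).
  by apply: is_derive_eq; rewrite /GRing.scale /=; field.
have d2 : is_derive y 1 (fun x : R => expR (- (x ^+ 2 * 2^-1)))
    (- y * expR (- (y ^+ 2 * 2^-1))).
  by rewrite mulrC; exact: (is_derive1_comp (is_derive_expR _) d1).
by apply: is_derive_eq; rewrite /GRing.scale /= [- _ ^+ 2 / 2]mulNr; ring.
Qed.

Lemma cvg_id_mul_std_normal_pdf : (fun x => x * phi x) @ +oo --> (0 : R).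
Proof.
apply/cvgrPdist_le => e e0.
have p0 : 0 < normal_peak (1 : R) by apply: normal_peak_gt0; rewrite oner_eq0.
near=> y.
have y0 : 0 < y by near: y; exact: nbhs_pinfty_gt.
rewrite sub0r normrN ger0_norm; last by rewrite mulr_ge0 ?normal_pdf_ge0 ?ltW.
rewrite std_normal_pdfE mulNr expRN.
(* The bound [t <= expR t] at [t = y ^+ 2 / 2] already gives decay of order [1 / y]. *)
have h : y ^+ 2 / 2 <= expR (y ^+ 2 / 2).
  by apply: le_trans (expR_ge1Dx _); rewrite lerDr.
have y20 : 0 < y ^+ 2 / 2 by rewrite divr_gt0// exprn_gt0.
apply: (@le_trans _ _ (y * (normal_peak 1 * (y ^+ 2 / 2)^-1))).
  by rewrite !ler_pM2l// lef_pV2// posrE// expR_gt0.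
have -> : y * (normal_peak 1 * (y ^+ 2 / 2)^-1) = 2 * normal_peak 1 / y.
  by field; rewrite gt_eqF.
rewrite ler_pdivrMr// -ler_pdivrMl//.
Unshelve. all: end_near. Qed.

(** [(1 - y ^+ 2) * phi y] is the derivative of [y * phi y], which vanishes at 0 and at infinity, so
    [y ^+ 2 * phi y] and [phi y] have equal integrals over the half-line. The sign of [1 - y ^+ 2]
    changes at 1; splitting there keeps every integrand non-negative, and the boundary value [phi 1]
    occurs once in each piece and cancels. *)
Lemma gauss_second_moment : (\int[gauss]_y (y ^+ 2)%:E = 1)%E.
Proof.
have cphi : continuous phi by apply: continuous_normal_pdf; rewrite oner_eq0.
have phi0 x : 0 <= phi x := normal_pdf_ge0 _ _ _.
have mphi := @measurable_std_normal_pdf R.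
have csq : continuous (fun x : R => x ^+ 2) by exact: exprn_continuous.
pose g (x : R) := x ^+ 2 * phi x.
have cg : continuous g by move=> x; apply: cvgM; [exact: csq|exact: cphi].
have mg : measurable_fun [set: R] g by exact: continuous_measurable_fun.
have g0 x : 0 <= g x by rewrite mulr_ge0// sqr_ge0.
have mE (D : set R) (h : R -> R) : measurable_fun [set: R] h ->
    measurable_fun D (EFin \o h).
  by move=> mh; apply/measurable_EFinP; exact: measurable_funTS.
have evenphi : phi =1 phi \o -%R by move=> x; rewrite /= !std_normal_pdfE sqrrN.
have eveng : g =1 g \o -%R by move=> x; rewrite /= /g sqrrN (evenphi x).
rewrite integral_gauss//; last 2 first.
- exact/measurable_EFinP.
- by move=> x; rewrite lee_fin sqr_ge0.
under eq_integral do rewrite -EFinM.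
rewrite -[RHS](@integral_normal_pdf R 0 1) (ge0_symfun_integralT g0)//.
rewrite (ge0_symfun_integralT phi0)//; congr (_ * _)%E.
have split_at1 (h : R -> R) : measurable_fun [set: R] h -> (forall x, 0 <= h x) ->
    (\int[mu]_(x in [set x | (0 <= x)%R]) (h x)%:E =
     \int[mu]_(x in `[0%R, 1%R]) (h x)%:E + \int[mu]_(x in `[1%R, +oo[) (h x)%:E)%E.
  move=> mh h0; rewrite -(@integral_itv_obnd_cbnd _ 1%R); last exact: mE.
  rewrite (_ : [set x : R | 0 <= x] = `[0%R, +oo[%classic); last first.
    by apply/seteqP; split => x /=; rewrite in_itv /= andbT.
  rewrite (@itv_bndbnd_setU _ _ _ (BRight (1 : R)))//; last by rewrite bnd_simp.
  rewrite ge0_integral_setU//=; [exact: mE|by move=> x _; rewrite lee_fin|].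
  rewrite disj_set2E; apply/eqP; rewrite -subset0 => x /= [].
  by rewrite !in_itv/= andbT => /andP[_ /le_lt_trans h1 /h1]; rewrite ltxx.
rewrite (split_at1 g)// (split_at1 phi)//.
have dF := is_derive_id_mul_std_normal_pdf.
have cF : continuous (fun x : R => x * phi x).
  by move=> x; apply: cvgM; [exact: cvg_id|exact: cphi].
have cq : continuous (fun x : R => (1 - x ^+ 2) * phi x).
  move=> x; apply: cvgM; last exact: cphi.
  by apply: cvgB; [exact: cvg_cst|exact: csq].
have E1 : (\int[mu]_(x in `[0%R, 1%R]) (phi x)%:E =
    (phi 1)%:E + \int[mu]_(x in `[0%R, 1%R]) (g x)%:E)%E.
  have -> : (phi 1)%:E = (\int[mu]_(x in `[0%R, 1%R]) ((1 - x ^+ 2) * phi x)%:E)%E.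
    rewrite (@continuous_FTC2 _ _ (fun x => x * phi x))//.
    - by rewrite mul0r mul1r sube0.
    - exact: continuous_subspaceT.
    - split => [x _| |].
      + exact: ex_derive.
      + by apply: cvg_at_right_filter; exact: cF.
      + by apply: cvg_at_left_filter; exact: cF.
    - by move=> x _; rewrite derive1E; exact: derive_val.
  rewrite -ge0_integralD//=.
  - by apply: eq_integral => x _; rewrite -EFinD /g; congr EFin; ring.
  - move=> x; rewrite in_itv /= => /andP[x0 x1].
    by rewrite lee_fin mulr_ge0// subr_ge0 expr_le1.
  - by apply: mE; exact: continuous_measurable_fun.
  - by move=> x _; rewrite lee_fin.
  - exact: mE.
have E2 : (\int[mu]_(x in `[1%R, +oo[) (g x)%:E =
    (phi 1)%:E + \int[mu]_(x in `[1%R, +oo[) (phi x)%:E)%E.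
  have cq' : continuous (fun x : R => (x ^+ 2 - 1) * phi x).
    move=> x; apply: cvgM; last exact: cphi.
    by apply: cvgB; [exact: csq|exact: cvg_cst].
  have dN (x : R) : is_derive x 1 (fun x => - (x * phi x)) (- ((1 - x ^+ 2) * phi x)).
    exact: is_deriveN.
  have -> : (phi 1)%:E = (\int[mu]_(x in `[1%R, +oo[) ((x ^+ 2 - 1) * phi x)%:E)%E.
    rewrite (@ge0_continuous_FTC2y _ _ (fun x => - (x * phi x)) _ 0)//.
    - by rewrite mul1r EFinN oppeK add0e.
    - move=> x x1; rewrite mulr_ge0// subr_ge0 expr_ge1//.
      exact: le_trans x1.
    - exact: continuous_subspaceT.
    - by have := cvgN cvg_id_mul_std_normal_pdf; rewrite oppr0; apply.
    - by apply: cvg_at_right_filter; apply: cvgN; exact: cF.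
    - by move=> x _; rewrite derive1E (@derive_val _ _ _ _ _ _ _ (dN x)); ring.
  rewrite -ge0_integralD//=.
  - by apply: eq_integral => x _; rewrite -EFinD /g; congr EFin; ring.
  - move=> x; rewrite in_itv /= andbT => x1.
    by rewrite lee_fin mulr_ge0// subr_ge0 expr_ge1// (le_trans _ x1).
  - by apply: mE; exact: continuous_measurable_fun.
  - by move=> x _; rewrite lee_fin.
  - exact: mE.
by rewrite E1 E2 addeCA addeA.
Qed.

Lemma ge0_integral_gauss_opp (f : R -> \bar R) : measurable_fun [set: R] f ->
  (forall x, 0 <= f x)%E ->
  (\int[gauss]_y f (- y)%R = \int[gauss]_y f y)%E.
Proof.
move=> mf f0.
have mphi := @measurable_std_normal_pdf R.
have phi0 x : 0 <= phi x := normal_pdf_ge0 _ _ _.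
pose F y := (f y * (phi y)%:E)%E.
have mF : measurable_fun [set: R] F by apply: emeasurable_funM => //; exact/measurable_EFinP.
have F0 y : (0 <= F y)%E by rewrite mule_ge0// lee_fin.
rewrite !integral_gauss//; last by apply: measurableT_comp.
transitivity (\int[mu]_y F (- y)%R)%E.
  by apply: eq_integral => y _; rewrite /F !std_normal_pdfE sqrrN.
have mopp : measurable_fun [set: measurableTypeR R]
    (-%R : _ -> measurableTypeR R) by exact: oppr_measurable.
transitivity (\int[pushforward mu (-%R : _ -> measurableTypeR R)]_y F y)%E.
  by rewrite (ge0_integral_pushforward mopp)// preimage_setT.
by apply: eq_measure_integral => A mA _; exact: lebesgue_measureN.
Qed.

End gaussian_moments.

(** * Test functions *)

Section smooth_test_functions.
Context {R : realType}.

(** One constant serves both bounds, since averaging preserves each of them with the same constant;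
    the Lipschitz bound also supplies measurability. *)
Definition bounded_lipschitz (B : R) (g : R -> R) :=
  (forall x, `|g x| <= B) /\ (forall x y, `|g x - g y| <= B * `|x - y|).

(* [f1] and [f2] stand for the first two derivatives.  The remainder bound
   involves only second moments of the increment, and, unlike differentiability,
   it passes through an expectation without any domination argument. *)
Definition smooth2 (B : R) (f f1 f2 : R -> R) :=
  [/\ forall x, 0 <= f x, bounded_lipschitz B f, bounded_lipschitz B f1,
      bounded_lipschitz B f2 &
      forall x h, `|f (x + h) - f x - f1 x * h - f2 x * (h ^+ 2 / 2)| <=
                  B * (h ^+ 2 * Num.min 1 `|h|)].

Lemma bounded_lipschitz_ge0 B g : bounded_lipschitz B g -> 0 <= B.
Proof. by case=> /(_ 0) h _; exact: le_trans h. Qed.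

Lemma bounded_lipschitz_continuous B g : bounded_lipschitz B g -> continuous g.
Proof.
move=> bg x; have B0 := bounded_lipschitz_ge0 bg; case: bg => _ lg.
apply/cvgrPdist_le => e e0; near=> y.
apply: le_trans (lg _ _) _.
apply: (@le_trans _ _ ((B + 1) * `|x - y|)); first by rewrite ler_wpM2r// lerDl.
rewrite mulrC -ler_pdivlMr; last by rewrite ltr_wpDl.
near: y; apply: cvgr_dist_le; first exact: cvg_id.
by rewrite divr_gt0// ltr_wpDl.
Unshelve. all: end_near. Qed.

Lemma bounded_lipschitz_measurable B g :
  bounded_lipschitz B g -> measurable_fun [set: R] g.
Proof. by move=> /bounded_lipschitz_continuous; exact: continuous_measurable_fun. Qed.

End smooth_test_functions.

(** * Averaging operators and their second-order expansion *)

Section averaging.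
Context d (T : measurableType d) (R : realType) (P : probability T R).
Implicit Types (X : T -> R) (f g h : R -> R).

Lemma bounded_integrable (u : T -> R) (B : R) : measurable_fun setT u ->
  (forall w, `|u w| <= B) -> P.-integrable setT (EFin \o u).
Proof.
move=> mu uB; have Py : (P setT < +oo)%E by rewrite probability_setT ltry.
apply: (measurable_bounded_integrable _ Py mu) => //.
exists B; split; first exact: num_real.
by move=> M BM w _; apply: le_trans (uB w) (ltW BM).
Qed.

Lemma integrable_realD (u v : T -> R) : P.-integrable setT (EFin \o u) ->
  P.-integrable setT (EFin \o v) ->
  P.-integrable setT (EFin \o (fun w => u w + v w)).
Proof. by move=> iu iv; exact: (integrableD _ iu iv). Qed.

Lemma integrable_realB (u v : T -> R) : P.-integrable setT (EFin \o u) ->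
  P.-integrable setT (EFin \o v) ->
  P.-integrable setT (EFin \o (fun w => u w - v w)).
Proof. by move=> iu iv; exact: (integrableB _ iu iv). Qed.

Lemma integrable_realZ (c : R) (u : T -> R) : P.-integrable setT (EFin \o u) ->
  P.-integrable setT (EFin \o (fun w => c * u w)).
Proof. by move=> iu; exact: (integrableZl _ _ iu). Qed.

Lemma dominated_integrable_real (u v : T -> R) : measurable_fun setT u ->
  P.-integrable setT (EFin \o v) -> (forall w, `|u w| <= v w) ->
  P.-integrable setT (EFin \o u).
Proof.
move=> mu iv uv; apply: le_integrable iv => //.
- exact/measurable_EFinP.
- by move=> w _ /=; rewrite lee_fin (le_trans (uv w))// ler_norm.
Qed.

Lemma square_integrable_integrable X : measurable_fun setT X ->
  P.-integrable setT (EFin \o (fun w => X w ^+ 2)) ->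
  P.-integrable setT (EFin \o X).
Proof.
move=> mX iX2; apply: (@dominated_integrable_real _ (fun w => 1 + X w ^+ 2)) => //.
- by apply: integrable_realD => //; exact: (@bounded_integrable (cst 1) `|1|).
- move=> w; rewrite -real_normK ?num_real//; set a := `|X w|.
  by have := sqr_ge0 (a - 2^-1); nra.
Qed.

Definition average X g x : R := \int[P]_w g (x + X w).

Section average_props.
Variables (X : T -> R).
Hypothesis mX : measurable_fun setT X.

Lemma average_integrable B g x : bounded_lipschitz B g ->
  P.-integrable setT (EFin \o (fun w => g (x + X w))).
Proof.
move=> bg; apply: (@bounded_integrable _ B); last by move=> w; apply: bg.1.
apply: measurableT_comp; first exact: bounded_lipschitz_measurable bg.
exact: measurable_funD.
Qed.

Lemma Rintegral_probability_cst (c : R) : \int[P]_w c = c.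
Proof. 
rewrite Rintegral_cst// [X in _ * X](_ : _ = 1) ?mulr1//.
exact: (congr1 fine (probability_setT P)).
 Qed.

Lemma normr_Rintegral_le (u : T -> R) (B : R) : P.-integrable setT (EFin \o u) ->
  (forall w, `|u w| <= B) -> `|\int[P]_w u w| <= B.
Proof.
move=> iu uB; apply: le_trans (le_normr_Rintegral _ iu) _ => //.
rewrite -[leRHS]Rintegral_probability_cst; apply: le_Rintegral => //.
- by apply: integrable_norm.
- by apply: (@bounded_integrable _ `|B|).
Qed.

Lemma average_bounded_lipschitz B g : bounded_lipschitz B g ->
  bounded_lipschitz B (average X g).
Proof.
move=> bg; split=> [x|x y].
  by apply: normr_Rintegral_le; [exact: average_integrable bg|move=> w; exact: bg.1].
have ix := average_integrable x bg; have iy := average_integrable y bg.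
rewrite /average -RintegralB//; apply: normr_Rintegral_le.
  exact: integrable_realB.
move=> w; have := bg.2 (x + X w) (y + X w).
by rewrite (_ : x + X w - (y + X w) = x - y)//; ring.
Qed.

(** Allows the induction over the summands to replace [f] by its average over the last one without
    any loss in [B]. *)
Lemma average_smooth2 B f f1 f2 : smooth2 B f f1 f2 ->
  smooth2 B (average X f) (average X f1) (average X f2).
Proof.
case=> f0 bf bf1 bf2 tf; split.
- by move=> x; apply: Rintegral_ge0.
- exact: average_bounded_lipschitz.
- exact: average_bounded_lipschitz.
- exact: average_bounded_lipschitz.
- move=> x h; rewrite /average.
  have i0 := average_integrable x bf; have ih := average_integrable (x + h) bf.
  have i1 := average_integrable x bf1; have i2 := average_integrable x bf2.
  have i1h : P.-integrable setT (EFin \o (fun w => f1 (x + X w) * h)).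
    by under eq_fun do rewrite mulrC; exact: integrable_realZ.
  have i2h : P.-integrable setT (EFin \o (fun w => f2 (x + X w) * (h ^+ 2 / 2))).
    by under eq_fun do rewrite mulrC; exact: integrable_realZ.
  have iA : P.-integrable setT (EFin \o (fun w => f (x + h + X w) - f (x + X w))).
    exact: (integrable_realB ih i0).
  have iB : P.-integrable setT (EFin \o (fun w => f (x + h + X w) - f (x + X w)
      - f1 (x + X w) * h)).
    exact: (integrable_realB iA i1h).
  rewrite -!RintegralZr// -RintegralB// -RintegralB// -RintegralB//.
  apply: normr_Rintegral_le; first exact: (integrable_realB iB i2h).
  by move=> w; rewrite (addrAC x h); exact: tf.
Qed.

Definition lindeberg : R := \int[P]_w (X w ^+ 2 * Num.min 1 `|X w|).

Hypothesis iX2 : P.-integrable setT (EFin \o (fun w => X w ^+ 2)).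

Lemma lindeberg_integrable :
  P.-integrable setT (EFin \o (fun w => X w ^+ 2 * Num.min 1 `|X w|)).
Proof.
apply: (dominated_integrable_real _ iX2).
  apply: measurable_funM; first exact: measurable_funX.
  by apply: measurable_minr => //; exact: measurableT_comp.
move=> w; rewrite normrM ger0_norm ?sqr_ge0// ler_piMr ?sqr_ge0//.
by rewrite ger0_norm ?ge_min ?lexx// le_min ler01 normr_ge0.
Qed.

(** The remainder bound is integrated at the increment [X w]: the linear term disappears because the
    mean is zero, and the quadratic one becomes [f2 x * (v / 2)]. *)
Lemma average_taylor (v B : R) f f1 f2 x : smooth2 B f f1 f2 ->
  \int[P]_w X w = 0 -> \int[P]_w (X w ^+ 2) = v ->
  `|average X f x - (f x + f2 x * (v / 2))| <= B * lindeberg.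
Proof.
case=> f0 bf bf1 bf2 tf EX EX2.
have iX := square_integrable_integrable mX iX2.
have i0 := average_integrable x bf.
have ic (c : R) : P.-integrable setT (EFin \o cst c).
  exact: (@bounded_integrable _ `|c|).
have iZ (c : R) (u : T -> R) := @integrable_realZ c u.
have iA : P.-integrable setT (EFin \o (fun w => f (x + X w) - f x)).
  exact: (integrable_realB i0 (ic _)).
have iB : P.-integrable setT (EFin \o (fun w => f (x + X w) - f x - f1 x * X w)).
  exact: (integrable_realB iA (iZ (f1 x) _ iX)).
have i2 : P.-integrable setT (EFin \o (fun w => f2 x * (X w ^+ 2 / 2))).
  rewrite (_ : (fun w => f2 x * _) = (fun w => f2 x / 2 * X w ^+ 2)); first exact: iZ.
  by apply/funext => w; ring.
have -> : average X f x - (f x + f2 x * (v / 2)) =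
    \int[P]_w (f (x + X w) - f x - f1 x * X w - f2 x * (X w ^+ 2 / 2)).
  rewrite RintegralB// RintegralB//; last exact: iZ.
  rewrite RintegralB//; last exact: (ic (f x)).
  rewrite Rintegral_probability_cst RintegralZl// EX mulr0 subr0.
  rewrite (_ : (fun w => f2 x * _) = (fun w => f2 x / 2 * X w ^+ 2)); last first.
    by apply/funext => w; ring.
  by rewrite RintegralZl// EX2 /average; ring.
apply: le_trans (le_normr_Rintegral _ _) _ => //.
  exact: (integrable_realB iB i2).
rewrite /lindeberg -RintegralZl//; last exact: lindeberg_integrable.
apply: le_Rintegral => //.
- by apply: integrable_norm => //; exact: (integrable_realB iB i2).
- by apply: iZ; exact: lindeberg_integrable.
Qed.

End average_props.
End averaging.

(* The increment in the Lindeberg replacement: both averages agree with the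
   same second-order Taylor polynomial. *)
Lemma average_replacement (R : realType) d1 (T1 : measurableType d1)
    (P1 : probability T1 R) d2 (T2 : measurableType d2) (P2 : probability T2 R)
    (X : T1 -> R) (N : T2 -> R) (v B : R) (f f1 f2 : R -> R) :
  measurable_fun setT X -> measurable_fun setT N ->
  P1.-integrable setT (EFin \o (fun w => X w ^+ 2)) ->
  P2.-integrable setT (EFin \o (fun w => N w ^+ 2)) ->
  \int[P1]_w X w = 0 -> \int[P2]_w N w = 0 ->
  \int[P1]_w (X w ^+ 2) = v -> \int[P2]_w (N w ^+ 2) = v ->
  smooth2 B f f1 f2 ->
  forall x, `|average P1 X f x - average P2 N f x| <=
            B * (lindeberg P1 X + lindeberg P2 N).
Proof.
move=> mX mN iX iN EX EN VX VN sf x.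
have h1 := average_taylor mX iX x sf EX VX.
have h2 := average_taylor mN iN x sf EN VN.
rewrite mulrDr; apply: le_trans (lerD h1 h2).
by rewrite [X in _ <= _ + X]distrC; apply: le_trans (ler_normD _ _); rewrite addrA subrK.
Qed.

(** * Independence of partial sums and the next summand *)

Section independence.
Context d (T : measurableType d) (R : realType) (P : probability T R).

Definition mutually_independent (X : nat -> T -> R) :=
  forall (J : seq nat) (A : nat -> set R),
    uniq J -> (forall i, i \in J -> measurable (A i)) ->
    P [set w | forall i, i \in J -> A i (X i w)] =
    (\big[*%E/1%E]_(i <- J) P (X i @^-1` A i))%E.

Section pair.
Variables (X Y : T -> R).
Hypotheses (mX : measurable_fun setT X) (mY : measurable_fun setT Y).

Let X' : {RV P >-> R} := HB.pack X (isMeasurableFun.Build _ _ _ _ _ mX).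
Let Y' : {RV P >-> R} := HB.pack Y (isMeasurableFun.Build _ _ _ _ _ mY).

Lemma measurable_fun_RVpair : measurable_fun setT (fun w => (X w, Y w)).
Proof. exact: measurable_fun_pair. Qed.

(* The extra event [C] carries the not yet used summands through the induction
   on partial sums. *)
Lemma joint_law (C : set T) : measurable C ->
  (forall A B, measurable A -> measurable B ->
    P (X @^-1` A `&` Y @^-1` B `&` C) =
    (P (X @^-1` A) * P (Y @^-1` B) * P C)%E) ->
  forall E : set (R * R), measurable E ->
  P ((fun w => (X w, Y w)) @^-1` E `&` C) =
  ((distribution P X' \x distribution P Y') E * P C)%E.
Proof.
move=> mC XYC E mE.
have PC0 : 0 <= fine (P C) by exact: fine_ge0.
pose r := NngNum PC0.
have rE : r%:num%:E = P C by rewrite /= fineK// fin_num_measure.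
have mXY := measurable_fun_RVpair.
pose m'0 : {measure set (R * R) -> \bar R} :=
  pushforward (mrestr P mC) (fun w => (X w, Y w)).
pose m' := m'0 mXY.
transitivity (m' E); first by [].
(* Restricting [P] to [C] leaves total mass [P C], so the comparison is with the product measure
   whose first factor is scaled by [P C]; agreement on rectangles is the hypothesis. *)
rewrite -(@product_measure_unique _ _ _ _ _ (mscale r (distribution P X'))
  (distribution P Y') m' _ E mE).
  rewrite /product_measure1 /= ge0_integral_mscale//; last first.
    exact: measurable_fun_xsection.
  by rewrite rE muleC.
move=> A B mA mB.
transitivity (P (X @^-1` A `&` Y @^-1` B `&` C)); first by [].
rewrite XYC// muleC muleA.
by transitivity (r%:num%:E * P (X @^-1` A) * P (Y @^-1` B))%E; first rewrite rE.
Qed.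

Hypothesis XY : forall A B, measurable A -> measurable B ->
  P (X @^-1` A `&` Y @^-1` B) = (P (X @^-1` A) * P (Y @^-1` B))%E.

Lemma independent_joint_law (E : set (R * R)) : measurable E ->
  P ((fun w => (X w, Y w)) @^-1` E) =
  ((distribution P X' \x distribution P Y') E)%E.
Proof.
move=> mE; have := joint_law measurableT _ mE.
rewrite setIT probability_setT mule1; apply => A B mA mB.
by rewrite setIT mule1 XY.
Qed.

(** The pair has the product law, so Tonelli integrates over [Y] first. This is where independence
    turns the law of a sum into a composition of averages. *)
Lemma independent_average (B : R) (g : R -> R) : (forall x, 0 <= g x) -> bounded_lipschitz B g ->
  \int[P]_w g (X w + Y w) = \int[P]_w average P Y g (X w).
Proof.
move=> g0 bg; rewrite /average /Rintegral; congr fine.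
have mg := bounded_lipschitz_measurable bg.
have mXY := measurable_fun_RVpair.
pose G (p : R * R) := (g (p.1 + p.2))%:E.
have mG : measurable_fun setT G.
  by apply/measurable_EFinP; apply: measurableT_comp => //; exact: measurable_funD.
have G0 p : (0 <= G p)%E by rewrite lee_fin.
transitivity (\int[pushforward P (fun w => (X w, Y w))]_p G p)%E.
  by rewrite ge0_integral_pushforward// preimage_setT.
transitivity (\int[distribution P X' \x distribution P Y']_p G p)%E.
  apply: eq_measure_integral => //= E mE _.
  exact: independent_joint_law.
rewrite fubini_tonelli1// /fubini_F ge0_integral_distribution//; last 2 first.
- exact: measurable_fun_fubini_tonelli_F.
- by move=> x; apply: integral_ge0.
apply: eq_integral => w _ /=.
rewrite ge0_integral_distribution//=; last first.
  apply/measurable_EFinP; apply: measurableT_comp => //=.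
  exact: measurable_funD.
rewrite fineK//.
rewrite integrable_fin_num//; exact: (average_integrable P mY _ bg).
Qed.

End pair.

Lemma independent_sum_event (X Y : T -> R) (C : set T) :
  measurable_fun setT X -> measurable_fun setT Y -> measurable C ->
  (forall A B, measurable A -> measurable B ->
    P (X @^-1` A `&` Y @^-1` B `&` C) =
    (P (X @^-1` A) * P (Y @^-1` B) * P C)%E) ->
  (forall A B, measurable A -> measurable B ->
    P (X @^-1` A `&` Y @^-1` B) = (P (X @^-1` A) * P (Y @^-1` B))%E) ->
  forall A, measurable A ->
  P ((fun w => X w + Y w) @^-1` A `&` C) =
  (P ((fun w => X w + Y w)%R @^-1` A) * P C)%E.
Proof.
move=> mX mY mC XYC XY A mA.
pose E := [set p : R * R | A (p.1 + p.2)].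
have mE : measurable E.
  have : measurable_fun [set: R * R] (fun p : R * R => p.1 + p.2).
    exact: measurable_funD.
  by move=> /(_ measurableT A mA); rewrite setTI.
have -> : (fun w => X w + Y w) @^-1` A = (fun w => (X w, Y w)) @^-1` E by [].
by rewrite (joint_law mX mY mC XYC mE) (independent_joint_law mX mY XY mE).
Qed.

Section partial_sums.
Variable X : nat -> T -> R.
Hypotheses (mX : forall i, measurable_fun setT (X i))
           (iX : mutually_independent X).

Let S k (w : T) := \sum_(i < k) X i w.
Let cyl (J : seq nat) (B : nat -> set R) :=
  [set w | forall i, i \in J -> B i (X i w)].

Lemma measurable_partial_sum k : measurable_fun setT (S k).
Proof. by apply: measurable_sum => i; exact: mX. Qed.

Let cyl_cons i J B : cyl (i :: J) B = X i @^-1` B i `&` cyl J B.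
Proof.
apply/seteqP; split => w /=.
  move=> h; split; first by apply: h; rewrite mem_head.
  by move=> j jJ; apply: h; rewrite in_cons jJ orbT.
by move=> [h1 h2] j; rewrite in_cons => /predU1P[->//|/h2].
Qed.

Let measurable_preim i (A : set R) : measurable A -> measurable (X i @^-1` A).
Proof. by move=> mA; rewrite -[X in measurable X]setTI; exact: mX. Qed.

Let measurable_cyl J B : (forall i, i \in J -> measurable (B i)) ->
  measurable (cyl J B).
Proof.
elim: J => [_|i J IH mB].
  by rewrite (_ : cyl _ _ = setT)//; apply/seteqP; split.
rewrite cyl_cons; apply: measurableI.
  by apply: measurable_preim; apply: mB; rewrite mem_head.
by apply: IH => j jJ; apply: mB; rewrite in_cons jJ orbT.
Qed.

(** Overriding [B] at the new index [k] turns the event on [X k] into one more factor of the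
    cylinder. The set equality is returned as well, because the induction hypothesis must be applied
    to the enlarged cylinder. *)
Let cylE k J B A : measurable A -> uniq J -> k \notin J ->
  (forall i, i \in J -> measurable (B i)) ->
  P (X k @^-1` A `&` cyl J B) = (P (X k @^-1` A) * P (cyl J B))%E /\
  X k @^-1` A `&` cyl J B = cyl (k :: J) (fun i => if i == k then A else B i).
Proof.
move=> mA uJ kJ mB; set B' := fun i => _.
have cylB' : cyl J B' = cyl J B.
  apply/seteqP; split => w h i iJ; have := h i iJ;
  by rewrite /B'; case: eqP => // ik; rewrite -ik iJ in kJ.
have e : X k @^-1` A `&` cyl J B = cyl (k :: J) B'.
  by rewrite cyl_cons cylB' /B' eqxx.
split=> //; rewrite e iX/=; last 2 first.
- by rewrite kJ.
- by move=> i; rewrite in_cons /B'; case: eqP => //= _; exact: mB.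
rewrite big_cons {1}/B' eqxx; congr (_ * _)%E.
rewrite -cylB' /cyl iX// => i iJ; rewrite /B'; case: eqP => // _; exact: mB.
Qed.

(** Induction on [k] with [J] left general: the step splits off [X k], and the induction hypothesis
    is then used with [k] moved into [J], which is legitimate as [J] only contains indices not below
    [k]. *)
Lemma partial_sum_independent k A J B : measurable A -> uniq J ->
  {in J, forall i, (k <= i)%N} -> (forall i, i \in J -> measurable (B i)) ->
  P (S k @^-1` A `&` cyl J B) = (P (S k @^-1` A) * P (cyl J B))%E.
Proof.
elim: k A J B => [|k IH] A J B mA uJ Jk mB.
  have -> : S 0 = cst 0 by apply/funext => w; rewrite /S big_ord0.
  have [A0|A0] := pselect (A 0).
    have -> : cst 0 @^-1` A = [set: T] by apply/seteqP; split.
    by rewrite setTI probability_setT mul1e.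
  have -> : cst 0 @^-1` A = @set0 T by apply/seteqP; split.
  by rewrite set0I measure0 mul0e.
have -> : S k.+1 = (fun w => S k w + X k w).
  by apply/funext => w; rewrite /S big_ord_recr.
have kJ : k \notin J by apply/negP => /Jk; rewrite ltnn.
have Jk' : {in J, forall i, (k <= i)%N} by move=> i /Jk /ltnW.
apply: independent_sum_event => //.
- exact: measurable_partial_sum.
- exact: measurable_cyl.
- move=> A1 A2 mA1 mA2; rewrite -setIA.
  have [e1 e2] := cylE mA2 uJ kJ mB.
  rewrite -muleA -e1 e2 IH//=.
  + by rewrite kJ.
  + by move=> i; rewrite in_cons => /predU1P[->//|/Jk'].
  + by move=> i; rewrite in_cons; case: eqP => //= _; exact: mB.
- move=> A1 A2 mA1 mA2.
  have := IH A1 [:: k] (fun=> A2) mA1 isT.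
  have -> : cyl [:: k] (fun=> A2) = X k @^-1` A2.
    apply/seteqP; split=> w /=; first by apply; rewrite mem_head.
    by move=> h i; rewrite inE => /eqP ->.
  by apply => // i; rewrite inE => /eqP ->.
Qed.

Lemma partial_sum_average k (B : R) (g : R -> R) : (forall x, 0 <= g x) -> bounded_lipschitz B g ->
  \int[P]_w g (\sum_(i < k.+1) X i w) =
  \int[P]_w average P (X k) g (\sum_(i < k) X i w).
Proof.
move=> g0 bg.
rewrite -(@independent_average (S k) (X k) (measurable_partial_sum k) (mX k) _ B)//.
  by apply: eq_Rintegral => w _; rewrite big_ord_recr.
move=> A1 A2 mA1 mA2.
have := @partial_sum_independent k A1 [:: k] (fun=> A2) mA1 isT.
have -> : cyl [:: k] (fun=> A2) = X k @^-1` A2.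
  apply/seteqP; split=> w /=; first by apply; rewrite mem_head.
  by move=> h i; rewrite inE => /eqP ->.
by apply => // i; rewrite inE => /eqP ->.
Qed.

End partial_sums.
End independence.

(** * Gaussian averages *)

Section gaussian_averages.
Context {R : realType}.
Notation gauss := (@normal_prob R 0 1).

(** The parameter is a standard deviation; [a = 0] gives the identity operator, so degenerate
    variances need no separate treatment. *)
Definition gauss_average (a : R) := average gauss (fun y : R => a * y).

Lemma gauss_square_integrable (a : R) :
  gauss.-integrable setT (EFin \o (fun y : R => (a * y) ^+ 2)).
Proof.
under eq_fun do rewrite exprMn.
apply: integrable_realZ; apply/integrableP; split.
  by apply/measurable_EFinP; exact: measurable_funX.
under eq_integral => y _ do rewrite /= ger0_norm ?sqr_ge0//.
by rewrite gauss_second_moment ltry.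
Qed.

Lemma gauss_variance (a : R) : \int[gauss]_y ((a * y) ^+ 2) = a ^+ 2.
Proof.
under eq_Rintegral do rewrite exprMn.
rewrite RintegralZl//; last first.
  by have := gauss_square_integrable 1; under eq_fun do rewrite mul1r.
by rewrite /Rintegral gauss_second_moment mulr1.
Qed.

Lemma gauss_integrable_id : gauss.-integrable setT (EFin \o (fun y : R => y)).
Proof.
apply: square_integrable_integrable => //.
by have := gauss_square_integrable 1; under eq_fun do rewrite mul1r.
Qed.

(** The negative part of [y] is the positive part of [- y], so by symmetry the two parts have equal
    integrals, and these are finite. *)
Lemma gauss_mean (a : R) : \int[gauss]_y (a * y) = 0.
Proof.
have iy := gauss_integrable_id.
rewrite RintegralZl// (_ : \int[gauss]_y y = 0) ?mulr0// /Rintegral integralE.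
have negE : ((fun y : R => y%:E) ^\- = (fun y : R => ((fun y : R => y%:E) ^\+ (- y)%R)))%E.
  by apply/funext => y; rewrite funenegE funeposE EFinN.
rewrite negE ge0_integral_gauss_opp//; last first.
  by apply: measurable_funepos; exact/measurable_EFinP.
rewrite subee//; have /integrable_fin_num := integrable_funepos measurableT iy.
by apply.
Qed.

Lemma gauss_average_semigroup (B a b x : R) (f : R -> R) : 0 <= a -> 0 <= b ->
  (forall x, 0 <= f x) -> bounded_lipschitz B f ->
  gauss_average a (gauss_average b f) x =
  gauss_average (Num.sqrt (a ^+ 2 + b ^+ 2)) f x.
Proof.
move=> a0 b0 f0 bf; rewrite /gauss_average /average /Rintegral.
have mf := bounded_lipschitz_measurable bf.
have mF : measurable_fun [set: R] (fun t => (f (x + t))%:E).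
  apply/measurable_EFinP; apply: measurableT_comp => //; exact: measurable_funD.
rewrite -(gauss_semigroup a0 b0 mF) => [|t]; last by rewrite lee_fin.
congr fine; apply: eq_integral => y _; rewrite fineK.
  by apply: eq_integral => z _; rewrite addrA.
have mb : measurable_fun [set: R] (fun z : R => b * z) by exact: measurable_funM.
by apply: integrable_fin_num => //; exact: (average_integrable gauss mb _ bf).
Qed.

(** Used to replace the variance at stage [n] by its limit. *)
Lemma gauss_average_lipschitz (B x : R) (f : R -> R) : bounded_lipschitz B f ->
  forall a b, `|gauss_average a f x - gauss_average b f x| <=
              B * (\int[gauss]_y `|y|) * `|a - b|.
Proof.
move=> bf a b; have B0 := bounded_lipschitz_ge0 bf.
have m (c : R) : measurable_fun [set: R] (fun z : R => c * z) by exact: measurable_funM.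
have ia := average_integrable gauss (m a) x bf.
have ib := average_integrable gauss (m b) x bf.
have iy : gauss.-integrable setT (EFin \o (fun y : R => `|y|)).
  exact: (integrable_norm gauss_integrable_id).
rewrite /gauss_average /average -RintegralB//.
apply: le_trans (le_normr_Rintegral _ _) _ => //; first exact: integrable_realB.
rewrite mulrAC -RintegralZl//; apply: le_Rintegral => //.
- by apply: integrable_norm => //; exact: integrable_realB.
- exact: integrable_realZ.
- move=> y _; apply: le_trans (bf.2 _ _) _.
  rewrite -mulrA -normrM ler_wpM2l// (_ : _ - _ = (a - b) * y)//; ring.
Qed.

End gaussian_averages.

(** Averaging contracts the uniform distance, so an error made in replacing one summand is not
    amplified by averaging over the others. *)
Lemma average_dist_le d (T : measurableType d) (R : realType)
    (P : probability T R) (X : T -> R) (B e x : R) (f g : R -> R) :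
  measurable_fun setT X -> bounded_lipschitz B f -> bounded_lipschitz B g ->
  (forall x, `|f x - g x| <= e) -> `|average P X f x - average P X g x| <= e.
Proof.
move=> mX bf bg fg; rewrite /average -RintegralB//; first last.
- exact: (average_integrable P mX x bg).
- exact: (average_integrable P mX x bf).
apply: normr_Rintegral_le => //; apply: integrable_realB.
- exact: (average_integrable P mX x bf).
- exact: (average_integrable P mX x bg).
Qed.

Section lindeberg_bound.
Context d (T : measurableType d) (R : realType) (P : probability T R).
Notation gauss := (@normal_prob R 0 1).

(** Induction on [n] with [f] general: the induction hypothesis is applied to the average of [f]
    over the last summand. *)
Lemma lindeberg_bound (X : nat -> T -> R) (v : nat -> R) (B : R) :
  mutually_independent P X ->
  (forall i, measurable_fun setT (X i)) ->
  (forall i, P.-integrable setT (EFin \o (fun w => X i w ^+ 2))) ->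
  (forall i, \int[P]_w X i w = 0) ->
  (forall i, \int[P]_w (X i w ^+ 2) = v i) ->
  forall (n : nat) (f f1 f2 : R -> R), smooth2 B f f1 f2 ->
  `|\int[P]_w f (\sum_(i < n) X i w) -
    gauss_average (Num.sqrt (\sum_(i < n) v i)) f 0| <=
  B * \sum_(i < n) (lindeberg P (X i) +
                    lindeberg gauss (fun y => Num.sqrt (v i) * y)).
Proof.
move=> indX mX iX EX VX.
have v0 i : 0 <= v i by rewrite -VX; apply: Rintegral_ge0 => w _; exact: sqr_ge0.
elim=> [|n IH] f f1 f2 sf.
  rewrite !big_ord0 mulr0 sqrtr0 /gauss_average /average.
  under eq_Rintegral do rewrite big_ord0.
  under [X in _ - X]eq_Rintegral do rewrite mul0r addr0.
  by rewrite !Rintegral_probability_cst subrr normr0.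
have [f0 bf bf1 bf2 _] := sf.
have mlin (c : R) : measurable_fun [set: R] (fun z : R => c * z) by exact: measurable_funM.
rewrite (partial_sum_average mX indX n f0 bf).
have sXf := average_smooth2 P (mX n) sf.
rewrite !big_ord_recr /= mulrDr.
set V := \sum_(i < n) v i; set L := \sum_(i < n) _.
have V0 : 0 <= V by apply: sumr_ge0.
have -> : Num.sqrt (V + v n) =
    Num.sqrt (Num.sqrt V ^+ 2 + Num.sqrt (v n) ^+ 2) by rewrite !sqr_sqrtr.
rewrite -(gauss_average_semigroup _ _ _ f0 bf) ?sqrtr_ge0//.
(* The intermediate term has its first [n] summands already Gaussian and the last one still
   distributed as [X n]. *)
apply: le_trans (ler_distD (gauss_average (Num.sqrt V) (average P (X n) f) 0) _ _) _.
apply: lerD; first exact: IH sXf.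
have sGf := average_smooth2 gauss (mlin (Num.sqrt (v n))) sf.
have [_ bXf _ _ _] := sXf; have [_ bGf _ _ _] := sGf.
rewrite /gauss_average; apply: (average_dist_le gauss 0 (mlin _) bXf bGf) => x.
apply: (@average_replacement R _ T P _ _ gauss (X n)
  (fun y => Num.sqrt (v n) * y) (v n) B f f1 f2 (mX n) (mlin _) (iX n)
  (gauss_square_integrable _) (EX n) (gauss_mean _) (VX n) _ sf).
by rewrite gauss_variance sqr_sqrtr.
Qed.

End lindeberg_bound.

(** * Truncated second moments *)

Section truncated_second_moment.
Context d (T : measurableType d) (R : realType) (P : probability T R).

(** What remains of [lindeberg] for [c * e] when [c ^+ 2] is taken out and [|c|] inside the minimum
    is raised to a common bound [m]. *)
Definition truncated_moment (e : T -> R) (m : R) : R :=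
  \int[P]_w (e w ^+ 2 * Num.min 1 (m * `|e w|)).

Variable e : T -> R.
Hypothesis me : measurable_fun setT e.
Hypothesis ie : P.-integrable setT (EFin \o (fun w => e w ^+ 2)).

Let measurable_truncated m :
  measurable_fun setT (fun w => e w ^+ 2 * Num.min 1 (m * `|e w|)).
Proof.
apply: measurable_funM; first exact: measurable_funX.
apply: measurable_minr => //; apply: measurable_funM => //.
exact: measurableT_comp.
Qed.

Let truncated_le m w : 0 <= m ->
  `|e w ^+ 2 * Num.min 1 (m * `|e w|)| <= e w ^+ 2.
Proof.
move=> m0; rewrite normrM ger0_norm ?sqr_ge0// ler_piMr ?sqr_ge0//.
by rewrite ger0_norm ?ge_min ?lexx// le_min ler01 mulr_ge0.
Qed.

Lemma truncated_integrable m : 0 <= m ->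
  P.-integrable setT (EFin \o (fun w => e w ^+ 2 * Num.min 1 (m * `|e w|))).
Proof.
move=> m0; apply: (dominated_integrable_real _ ie) => // w.
exact: truncated_le.
Qed.

Lemma truncated_moment_cvg0 (m : nat -> R) : (forall n, 0 <= m n) ->
  m @ \oo --> (0 : R) -> (fun n => truncated_moment e (m n)) @ \oo --> (0 : R).
Proof.
move=> m0 mcvg.
have := @dominated_convergence _ _ _ P setT measurableT
  (fun n w => (e w ^+ 2 * Num.min 1 (m n * `|e w|))%:E) (cst 0)
  (EFin \o (fun w => e w ^+ 2)).
case.
- by move=> n; apply/measurable_EFinP; exact: measurable_truncated.
- by [].
- apply: nearW => w _ /=; apply/cvg_EFin; first by apply: nearW.
  rewrite (_ : fine \o _ = (fun n => e w ^+ 2 * Num.min 1 (m n * `|e w|)))//.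
  have h : (fun n => e w ^+ 2 * (m n * `|e w|)) @ \oo --> (0 : R).
    rewrite -[X in _ --> X](mulr0 (e w ^+ 2)); apply: cvgMl_tmp.
    by rewrite -[X in _ --> X](mul0r `|e w|); exact: cvgMr_tmp.
  apply: squeeze_cvgr (cvg_cst 0) h; apply: nearW => n.
  rewrite mulr_ge0 ?sqr_ge0//= ?le_min ?ler01 ?mulr_ge0//.
  by rewrite ler_wpM2l ?sqr_ge0// ge_min lexx orbT.
- exact: ie.
- by apply: nearW => w n _; rewrite /= lee_fin truncated_le.
move=> _ _; rewrite integral0 => /fine_cvgP[_]; exact.
Qed.

Lemma lindeberg_scale (c m : R) : `|c| <= m ->
  lindeberg P (fun w => c * e w) <= c ^+ 2 * truncated_moment e m.
Proof.
move=> cm; have m0 : 0 <= m by exact: le_trans cm.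
rewrite /lindeberg /truncated_moment -RintegralZl//; last exact: truncated_integrable.
apply: le_Rintegral => //.
- apply: (@lindeberg_integrable _ _ _ _ (fun w => c * e w)).
    exact: measurable_funM.
  by under eq_fun do rewrite exprMn; exact: integrable_realZ.
- exact/integrable_realZ/truncated_integrable.
- move=> w _; rewrite exprMn -mulrA ler_wpM2l ?sqr_ge0// ler_wpM2l ?sqr_ge0//.
  by rewrite le_min !ge_min lexx /= normrM ler_wpM2r ?orbT.
Qed.

End truncated_second_moment.

(** * The central limit theorem for weighted sums, on test functions *)

Section clt.
Context d (T : measurableType d) (R : realType) (P : probability T R).
Notation gauss := (@normal_prob R 0 1).

Lemma mutually_independent_scale (e : nat -> T -> R) (c : nat -> R) :
  mutually_independent P e -> mutually_independent P (fun i w => c i * e i w).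
Proof.
move=> ie J A uJ mA.
have := ie J (fun i => [set x | A i (c i * x)]) uJ; apply => i iJ.
have : measurable_fun [set: R] (fun x : R => c i * x) by exact: measurable_funM.
by move=> /(_ measurableT _ (mA i iJ)); rewrite setTI.
Qed.

Definition same_law (X Y : T -> R) :=
  forall A : set R, measurable A -> P (X @^-1` A) = P (Y @^-1` A).

Lemma same_law_Rintegral (X Y : T -> R) (h : R -> R) :
  measurable_fun setT X -> measurable_fun setT Y -> same_law X Y ->
  measurable_fun [set: R] h -> (forall x, 0 <= h x) ->
  \int[P]_w h (X w) = \int[P]_w h (Y w).
Proof.
move=> mX mY XY mh h0; rewrite /Rintegral; congr fine.
have mh' : measurable_fun [set: R] (EFin \o h) by exact/measurable_EFinP.
transitivity (\int[pushforward P X]_x (h x)%:E)%E.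
  by rewrite ge0_integral_pushforward// ?preimage_setT// => x _; rewrite lee_fin.
transitivity (\int[pushforward P Y]_x (h x)%:E)%E; last first.
  by rewrite ge0_integral_pushforward// ?preimage_setT// => x _; rewrite lee_fin.
by apply: eq_measure_integral => A mA _; exact: XY.
Qed.

Variables (e : nat -> T -> R) (s2 : R).
Hypothesis me : forall i, measurable_fun setT (e i).
Hypothesis ie : forall i, P.-integrable setT (EFin \o (fun w => e i w ^+ 2)).
Hypothesis Ee : forall i, \int[P]_w e i w = 0.
Hypothesis Ve : \int[P]_w (e 0%N w ^+ 2) = s2.
Hypothesis inde : mutually_independent P e.
Hypothesis lawe : forall i, same_law (e i) (e 0%N).

(** Equality of laws makes the truncated moment the same for all [i], so the individual errors add
    up to the sum of the [c i ^+ 2]. The matching Gaussian has scale [|c i| * sqrt s2], hence the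
    factor [s2] and the truncation level [sqrt s2 * m]. *)
Lemma weighted_clt_bound (n : nat) (c : nat -> R) (m B : R) (f f1 f2 : R -> R) :
  0 <= m -> (forall i, (i < n)%N -> `|c i| <= m) -> smooth2 B f f1 f2 ->
  `|\int[P]_w f (\sum_(i < n) c i * e i w) -
    gauss_average (Num.sqrt (s2 * \sum_(i < n) c i ^+ 2)) f 0| <=
  B * ((\sum_(i < n) c i ^+ 2) * (truncated_moment P (e 0%N) m +
    s2 * truncated_moment gauss id (Num.sqrt s2 * m))).
Proof.
move=> m0 cm sf.
have Vi i : \int[P]_w (e i w ^+ 2) = s2.
  rewrite -Ve; apply: (same_law_Rintegral (h := fun x => x ^+ 2)) => // x.
  exact: sqr_ge0.
have s20 : 0 <= s2 by rewrite -Ve; apply: Rintegral_ge0 => w _; exact: sqr_ge0.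
have mt : measurable_fun [set: R] (fun x : R => x ^+ 2 * Num.min 1 (m * `|x|)).
  apply: measurable_funM => //; apply: measurable_minr => //.
  by apply: measurable_funM => //; exact: measurableT_comp.
have ti i : truncated_moment P (e i) m = truncated_moment P (e 0%N) m.
  apply: (same_law_Rintegral (h := fun x => x ^+ 2 * Num.min 1 (m * `|x|))) => // x.
  by rewrite mulr_ge0 ?sqr_ge0// le_min ler01 mulr_ge0.
have [f0 bf _ _ _] := sf; have B0 := bounded_lipschitz_ge0 bf.
have h : `|\int[P]_w f (\sum_(i < n) c i * e i w) -
    gauss_average (Num.sqrt (\sum_(i < n) c i ^+ 2 * s2)) f 0| <=
  B * \sum_(i < n) (lindeberg P (fun w => c i * e i w) +
                    lindeberg gauss (fun y => Num.sqrt (c i ^+ 2 * s2) * y)).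
  apply: (@lindeberg_bound _ _ _ P (fun i w => c i * e i w)
    (fun i => c i ^+ 2 * s2)) sf.
  - exact: mutually_independent_scale.
  - by move=> i; exact: measurable_funM.
  - by move=> i; under eq_fun do rewrite exprMn; exact: integrable_realZ.
  - move=> i; rewrite RintegralZl ?Ee ?mulr0//.
    exact: square_integrable_integrable.
  - move=> i; under eq_Rintegral do rewrite exprMn.
    by rewrite RintegralZl ?Vi//.
rewrite mulrC mulr_suml; apply: le_trans h _.
rewrite ler_wpM2l// mulr_suml; apply: ler_sum => i _.
rewrite mulrDr -(ti i); apply: lerD.
  exact: lindeberg_scale (cm _ _).
have -> : c i ^+ 2 * (s2 * truncated_moment gauss id (Num.sqrt s2 * m)) =
    Num.sqrt (c i ^+ 2 * s2) ^+ 2 * truncated_moment gauss id (Num.sqrt s2 * m).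
  by rewrite sqr_sqrtr ?mulrA// mulr_ge0// sqr_ge0.
apply: (@lindeberg_scale _ _ _ gauss id).
- by [].
- by have := @gauss_square_integrable R 1; under eq_fun do rewrite mul1r.
- rewrite ger0_norm ?sqrtr_ge0// sqrtrM ?sqr_ge0// sqrtr_sqr mulrC.
  by rewrite ler_wpM2l ?sqrtr_ge0// cm.
Qed.

Lemma weighted_clt (c : nat -> nat -> R) (m : nat -> R) (v B : R) (f f1 f2 : R -> R) :
  (fun n => \sum_(i < n) c n i ^+ 2) @ \oo --> v ->
  m @ \oo --> (0 : R) ->
  (forall n i, (i < n)%N -> `|c n i| <= m n) ->
  smooth2 B f f1 f2 ->
  (fun n => \int[P]_w f (\sum_(i < n) c n i * e i w)) @ \oo -->
  gauss_average (Num.sqrt (s2 * v)) f 0.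
Proof.
move=> cv m0 cm sf; have [f0 bf _ _ _] := sf.
(* [m 0] may be negative, as no index constrains it, whereas truncation levels must be
   non-negative. *)
have am0 : (fun n => `|m n|) @ \oo --> (0 : R).
  by rewrite -(normr0 R); exact: cvg_norm.
have t1 := @truncated_moment_cvg0 _ _ _ P (e 0%N) (me 0) (ie 0) _ (fun n => normr_ge0 _) am0.
have t2 : (fun n => truncated_moment gauss id (Num.sqrt s2 * `|m n|)) @ \oo --> (0 : R).
  apply: (@truncated_moment_cvg0 _ _ _ gauss id).
  - by [].
  - by have := @gauss_square_integrable R 1; under eq_fun do rewrite mul1r.
  - by move=> n; rewrite mulr_ge0 ?sqrtr_ge0.
  - by rewrite -[X in _ --> X](mulr0 (Num.sqrt s2)); exact: cvgMl_tmp.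
set sc := (fun n => \sum_(i < n) c n i ^+ 2) in cv *.
have bnd : (fun n => B * (sc n * (truncated_moment P (e 0%N) `|m n| +
    s2 * truncated_moment gauss id (Num.sqrt s2 * `|m n|)))) @ \oo --> (0 : R).
  rewrite [X in _ --> X](_ : 0 = B * (v * (0 + s2 * 0))); last by rewrite !(mulr0, addr0).
  exact: (cvgMl_tmp (cvgM cv (cvgD t1 (cvgMl_tmp t2)))).
have g1 : (fun n => gauss_average (Num.sqrt (s2 * sc n)) f 0) @ \oo -->
    gauss_average (Num.sqrt (s2 * v)) f 0.
  have sq : (fun n => Num.sqrt (s2 * sc n)) @ \oo --> Num.sqrt (s2 * v).
    apply: (cvg_comp (fun n => s2 * sc n) Num.sqrt (cvgMl_tmp cv)).
    exact: sqrt_continuous.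
  apply/subr_cvg0; apply/norm_cvg0P.
  have K0 : (fun n => B * (\int[gauss]_y `|y|) *
      `|Num.sqrt (s2 * sc n) - Num.sqrt (s2 * v)|) @ \oo --> (0 : R).
    rewrite -[X in _ --> X](mulr0 (B * (\int[gauss]_y `|y|))); apply: cvgMl_tmp.
    by apply/norm_cvg0P/subr_cvg0.
  apply: squeeze_cvgr (cvg_cst 0) K0; apply: nearW => n.
  by rewrite normr_ge0 /=; exact: gauss_average_lipschitz.
have d0 : (fun n => \int[P]_w f (\sum_(i < n) c n i * e i w) -
    gauss_average (Num.sqrt (s2 * sc n)) f 0) @ \oo --> (0 : R).
  apply/norm_cvg0P; apply: squeeze_cvgr (cvg_cst 0) bnd; apply: nearW => n.
  rewrite normr_ge0 /=; apply: weighted_clt_bound sf => // i ni.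
  exact: le_trans (cm _ _ ni) (ler_norm _).
rewrite -[X in _ --> X]add0r.
apply: cvg_trans (cvgD d0 g1).
by apply: near_eq_cvg; apply: nearW => n /=; rewrite fctE subrK.
Qed.

End clt.

(** * Smooth steps built from the logistic function *)

Section logistic.
Context {R : realType}.
Implicit Types (g dg : R -> R).

(** The derivative is bounded only at points no farther from [a] than [b] is; this local form lets
    the Taylor estimate be obtained by applying it twice from 0. *)
Lemma MVT_dist_le g dg (a b M : R) :
  (forall x : R, is_derive x 1 g (dg x)) ->
  (forall x, `|x - a| <= `|b - a| -> `|dg x| <= M) ->
  `|g b - g a| <= M * `|b - a|.
Proof.
move=> dgg dgM.
have cg (u v : R) : {within `[u, v], continuous g}.
  apply: derivable_within_continuous => x _; exact: ex_derive.
have [ab|/ltW ba] := leP a b.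
  have [c] := @MVT_segment R g dg a b ab (fun x _ => dgg x) (cg _ _).
  rewrite in_itv /= => /andP[ac cb] ->; rewrite normrM ler_wpM2r//; apply: dgM.
  by rewrite !ger0_norm ?subr_ge0// lerD2r.
have [c] := @MVT_segment R g dg b a ba (fun x _ => dgg x) (cg _ _).
rewrite in_itv /= => /andP[bc ca] e; rewrite distrC e normrM [X in _ <= _ * X]distrC.
by rewrite ler_wpM2r//; apply: dgM; rewrite !ler0_norm ?subr_le0// lerN2 lerD2r.
Qed.

(** The increment of [g2] is at most 2 and at most [|t|], hence at most [2 * min 1 |t|]; two
    applications of the mean value inequality, to [q] and then to [r], contribute a factor [|h|]
    each. *)
Lemma taylor2_remainder_le g (g1 g2 g3 : R -> R) :
  (forall x : R, is_derive x 1 g (g1 x)) ->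
  (forall x : R, is_derive x 1 g1 (g2 x)) ->
  (forall x : R, is_derive x 1 g2 (g3 x)) ->
  (forall x, `|g2 x| <= 1) -> (forall x, `|g3 x| <= 1) ->
  forall x h, `|g (x + h) - g x - g1 x * h - g2 x * (h ^+ 2 / 2)| <=
              2 * (h ^+ 2 * Num.min 1 `|h|).
Proof.
move=> d1 d2 d3 b2 b3 x h.
pose q t := g1 (x + t) - g1 x - g2 x * t.
pose r t := g (x + t) - g x - g1 x * t - g2 x * (t ^+ 2 * 2^-1).
have dsh (k dk : R -> R) (t : R) : (forall x : R, is_derive x 1 k (dk x)) ->
    is_derive t 1 (fun t => k (x + t)) (dk (x + t)).
  move=> dk'.
  have ds : is_derive t 1 (fun t : R => x + t) 1.
    by apply: is_derive_eq; rewrite add0r mulr1.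
  by have := is_derive1_comp (dk' (x + t)) ds; rewrite mulr1.
have dq (t : R) : is_derive t 1 q (g2 (x + t) - g2 x).
  have ds := dsh _ _ t d2.
  by apply: is_derive_eq; rewrite /GRing.scale /=; ring.
have dr (t : R) : is_derive t 1 r (q t).
  have ds := dsh _ _ t d1.
  by apply: is_derive_eq; rewrite /GRing.scale /q /=; field.
have lip2 t : `|g2 (x + t) - g2 x| <= 2 * Num.min 1 `|t|.
  have h1 : `|g2 (x + t) - g2 x| <= 1 * `|x + t - x|.
    by apply: MVT_dist_le d3 _ => y _; exact: b3.
  have e : x + t - x = t by ring.
  rewrite mul1r e in h1.
  have h2 : `|g2 (x + t) - g2 x| <= 2.
    by apply: le_trans (ler_normB _ _) _; have := b2 (x + t); have := b2 x; lra.
  by case: (leP 1 `|t|) => _; [lra|apply: le_trans h1 _; have := normr_ge0 t; lra].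
have q0 : q 0 = 0 by rewrite /q addr0; ring.
have r0 : r 0 = 0 by rewrite /r addr0; ring.
have mono s t : `|s| <= `|t| -> Num.min 1 `|s| <= Num.min 1 `|t| :> R.
  by move=> st; rewrite le_min !ge_min lexx st orbT.
have min0 t : 0 <= Num.min 1 `|t| :> R by rewrite le_min ler01 normr_ge0.
have qle t : `|q t| <= 2 * Num.min 1 `|t| * `|t|.
  have := @MVT_dist_le q _ 0 t (2 * Num.min 1 `|t|) dq.
  rewrite !subr0 q0 subr0; apply => y; rewrite subr0 => yt.
  by apply: le_trans (lip2 y) _; rewrite ler_pM2l// mono.
have := @MVT_dist_le r _ 0 h (2 * Num.min 1 `|h| * `|h|) dr.
rewrite !subr0 r0 subr0 /r => H; apply: le_trans (H _) _.
  move=> y; rewrite subr0 => yh; apply: le_trans (qle y) _.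
  by apply: ler_pM => //; rewrite ?mulr_ge0// ler_pM2l// mono.
by rewrite -(real_normK (num_real h)) expr2; lra.
Qed.

(** Reflected from the usual convention: it decreases from 1 to 0, like the indicator of a lower
    ray. Its derivatives are polynomials in itself, so bounding them is arithmetic on [[0, 1]]. *)
Definition logistic (x : R) : R := (1 + expR x)^-1.

Lemma logistic_gt0 x : 0 < logistic x.
Proof. by rewrite invr_gt0 addr_gt0// expR_gt0. Qed.

Lemma logistic_le1 x : logistic x <= 1.
Proof. by rewrite invf_le1 ?lerDl ?expR_ge0// addr_gt0// expR_gt0. Qed.

Lemma is_derive_logistic (x : R) :
  is_derive x 1 logistic (logistic x ^+ 2 - logistic x).
Proof.
have e0 : 1 + expR x != 0 by rewrite gt_eqF// addr_gt0// expR_gt0.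
have d1 : is_derive x 1 (fun x : R => 1 + expR x) (expR x).
  by apply: is_derive_eq; rewrite !(add0r, mulr1, mul1r).
rewrite (_ : _ - _ = - (1 + expR x) ^- 2 *: expR x); first exact: is_deriveV.
by rewrite /logistic /GRing.scale /=; field.
Qed.

(** The first three derivatives of [logistic] are bounded by 1, and each differentiation brings out
    a factor [K]; as [K >= 1], [K ^+ 3] dominates. The 2 comes from the Taylor remainder, where also
    [min 1 (K * |h|) <= K * min 1 |h|]. *)
Lemma smooth2_logistic (K c : R) : 1 <= K ->
  smooth2 (2 * K ^+ 3) (fun y => logistic (K * (y - c)))
    (fun y => K * (logistic (K * (y - c)) ^+ 2 - logistic (K * (y - c))))
    (fun y => K ^+ 2 * ((2 * logistic (K * (y - c)) - 1) *
                 (logistic (K * (y - c)) ^+ 2 - logistic (K * (y - c))))).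
Proof.
move=> K1; have K0 : 0 < K by exact: lt_le_trans K1.
pose g := logistic.
pose g1 x := g x ^+ 2 - g x.
pose g2 x := (2 * g x - 1) * (g x ^+ 2 - g x).
pose g3 x := (g x ^+ 2 - g x) * (2 * (g x ^+ 2 - g x) + (2 * g x - 1) ^+ 2).
have d0 (x : R) : is_derive x 1 g (g1 x) := is_derive_logistic x.
have d1 (x : R) : is_derive x 1 g1 (g2 x).
  have := d0 x => dx; apply: is_derive_eq; rewrite /GRing.scale /g1 /g2 /=; ring.
have d2 (x : R) : is_derive x 1 g2 (g3 x).
  have := d0 x => dx; have := d1 x => dx1.
  apply: is_derive_eq; rewrite /GRing.scale /g1 /g2 /g3 /=; ring.
have g01 x : 0 <= g x <= 1 by rewrite ltW ?logistic_gt0//= logistic_le1.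
have b0 x : `|g x| <= 1 by have := g01 x; rewrite ler_norml; lra.
have b1 x : `|g1 x| <= 1.
  by have /andP[h1 h2] := g01 x; rewrite ler_norml /g1; apply/andP; split; nra.
have b2 x : `|g2 x| <= 1.
  rewrite /g2 normrM; apply: mulr_ile1 => //; last exact: b1.
  by have /andP[h1 h2] := g01 x; rewrite ler_norml; apply/andP; split; lra.
have b3 x : `|g3 x| <= 1.
  rewrite /g3 normrM; apply: mulr_ile1 => //; first exact: b1.
  by have /andP[h1 h2] := g01 x; rewrite ler_norml; apply/andP; split; nra.
have KK (n : nat) : (n <= 3)%N -> K ^+ n <= 2 * K ^+ 3.
  move=> n3; apply: (@le_trans _ _ (K ^+ 3)); first exact: ler_weXn2l.
  by have := exprn_ge0 3 (ltW K0); lra.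
have bl (n : nat) (k dk : R -> R) : (n < 3)%N ->
    (forall x : R, is_derive x 1 k (dk x)) -> (forall x, `|k x| <= 1) ->
    (forall x, `|dk x| <= 1) ->
    bounded_lipschitz (2 * K ^+ 3) (fun y => K ^+ n * k (K * (y - c))).
  move=> n3 dk' bk bdk; have Kn0 : 0 <= K ^+ n by rewrite exprn_ge0// ltW.
  split=> [x|x y].
    rewrite normrM ger0_norm//; apply: le_trans (KK n (ltnW n3)).
    by rewrite ler_piMr.
  rewrite -mulrBr normrM ger0_norm//.
  have lk : `|k (K * (x - c)) - k (K * (y - c))| <= 1 * `|K * (x - c) - K * (y - c)|.
    by apply: MVT_dist_le dk' _ => z _; exact: bdk.
  apply: le_trans (ler_wpM2l Kn0 lk) _.
  rewrite mul1r (_ : K * (x - c) - K * (y - c) = K * (x - y)); last by ring.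
  by rewrite normrM (ger0_norm (ltW K0)) mulrA -exprSr ler_wpM2r// KK.
split.
- by move=> x; rewrite ltW// logistic_gt0.
- by have := bl 0%N g g1 isT d0 b0 b1; under eq_fun do rewrite expr0 mul1r.
- by have := bl 1%N g1 g2 isT d1 b1 b2; under eq_fun do rewrite expr1.
- exact: (bl 2%N g2 g3 isT d2 b2 b3).
- move=> x h.
  have := taylor2_remainder_le d0 d1 d2 b2 b3 (K * (x - c)) (K * h).
  rewrite -[K * (x - c) + K * h]mulrDr [x - c + h]addrAC => H.
  apply: le_trans (le_trans _ H) _.
    by rewrite le_eqVlt; apply/orP; left; apply/eqP; congr `|_|; rewrite /g1 /g2 /g; ring.
  rewrite exprMn normrM (ger0_norm (ltW K0)) -(mulrA 2) ler_pM2l//.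
  rewrite (_ : K ^+ 3 * _ = K ^+ 2 * h ^+ 2 * (K * Num.min 1 `|h|)); last by ring.
  apply: ler_wpM2l; first exact: (mulr_ge0 (sqr_ge0 K) (sqr_ge0 h)).
  have := normr_ge0 h; case: (leP 1 `|h|) => h1 h0; rewrite ge_min.
    by rewrite mulr1 K1.
  by rewrite lexx orbT.
Qed.

Lemma smooth_step (a b eps : R) : a < b -> 0 < eps ->
  exists B f f1 f2, [/\ smooth2 B f f1 f2,
    forall y, f y <= 1,
    forall y, y <= a -> 1 - eps <= f y &
    forall y, b < y -> f y <= eps].
Proof.
move=> ab e0.
pose c := (a + b) / 2; pose dl := (b - a) / 2.
have dl0 : 0 < dl by rewrite divr_gt0// subr_gt0.
(* With this slope [K * dl = dl + eps^-1], so [1 + t <= expR t] yields [eps^-1 <= expR (K * dl)];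
   the leading 1 ensures [1 <= K]. *)
pose K := 1 + (eps * dl)^-1.
have K1 : 1 <= K by rewrite lerDl invr_ge0 mulr_ge0// ltW.
have K0 : 0 < K by exact: lt_le_trans K1.
have Kexp : eps^-1 <= expR (K * dl).
  apply: le_trans (expR_ge1Dx _).
  rewrite /K mulrDl mul1r invfM -mulrA mulVf ?gt_eqF// mulr1; lra.
have Kexp' : expR (- (K * dl)) <= eps.
  by rewrite expRN -(invrK eps) lef_pV2 ?posrE ?invr_gt0// ?expR_gt0.
exists (2 * K ^+ 3); do 3 eexists; split; first exact: (smooth2_logistic c K1).
- by move=> y; exact: logistic_le1.
- move=> y ya /=.
  have h : expR (K * (y - c)) <= eps.
    apply: le_trans Kexp'; rewrite ler_expR.
    have -> : - (K * dl) = K * (a - c) by rewrite /c /dl; field.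
    by rewrite ler_pM2l// lerD2r.
  have p := expR_gt0 (K * (y - c)); rewrite /logistic.
  set u := expR _ in h p *; have u1 : 0 < 1 + u by rewrite addr_gt0.
  by rewrite -[leRHS]mul1r ler_pdivlMr//; nra.
- move=> y yb /=; rewrite /logistic.
  apply: le_trans Kexp'; rewrite expRN lef_pV2 ?posrE ?expR_gt0 ?addr_gt0 ?expR_gt0//.
  apply: (@le_trans _ _ (expR (K * (y - c)))); last by rewrite lerDr.
  by rewrite ler_expR ler_pM2l// /c /dl; lra.
Qed.

End logistic.

(** * From test functions to distribution functions *)

Section cdf_bounds.
Context {R : realType}.
Notation gauss := (@normal_prob R 0 1).

(** Point mass at 0 is the law of [Num.sqrt 0 * y], so the separate branch of [normal_cdf] obeys the
    same formula. *)
Lemma normal_cdfE (v x : R) : 0 <= v ->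
  normal_cdf v x = fine (gauss [set y | Num.sqrt v * y <= x]).
Proof.
rewrite /normal_cdf le_eqVlt => /predU1P[<-|v0].
  rewrite eqxx sqrtr0; case: ifPn => x0.
    rewrite (_ : [set y | _] = setT); last first.
      by apply/seteqP; split => y //= _; rewrite mul0r.
    by rewrite probability_setT.
  rewrite (_ : [set y | _] = set0) ?measure0//.
  by apply/seteqP; split => y //=; rewrite mul0r (negbTE x0).
by rewrite gt_eqF// normal_prob_ray// sqrtr_gt0.
Qed.

Section one_variable.
Context d (T : measurableType d) (P : probability T R).
Variables (U : T -> R).
Hypothesis mU : measurable_fun setT U.

Lemma measurable_sublevel (a : R) : measurable [set w | U w <= a].
Proof.
rewrite (_ : [set w | _] = U @^-1` `]-oo, a]).
  by rewrite -[X in measurable X]setTI; exact: mU.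
by apply/seteqP; split => w /=; rewrite in_itv.
Qed.

Let indic_integrable (A : set T) : measurable A ->
  P.-integrable setT (EFin \o (\1_A : T -> R)).
Proof.
move=> mA; apply: (@bounded_integrable _ _ _ _ _ 1) => [|w].
  exact: measurable_indic.
by rewrite indicE ger0_norm// lern1 leq_b1.
Qed.

Let prob_Rintegral (A : set T) : measurable A -> fine (P A) = \int[P]_w \1_A w.
Proof. by move=> mA; rewrite /Rintegral integral_indic// setIT. Qed.

Variables (B : R) (f : R -> R) (a b eta : R).
Hypothesis bf : bounded_lipschitz B f.
Hypothesis f0 : forall y, 0 <= f y.
Hypothesis f1 : forall y, f y <= 1.
Hypothesis eta0 : 0 < eta.

Let fU_integrable : P.-integrable setT (EFin \o (fun w => f (U w))).
Proof.
apply: (@bounded_integrable _ _ _ _ _ B); last by move=> w; exact: bf.1.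
by apply: measurableT_comp => //; exact: bounded_lipschitz_measurable bf.
Qed.

Let cst_integrable (c : R) : P.-integrable setT (EFin \o (fun _ : T => c)).
Proof. by apply: (@bounded_integrable _ _ _ _ _ `|c|). Qed.

Lemma prob_le_step : (forall y, y <= a -> 1 - eta <= f y) ->
  fine (P [set w | U w <= a]) <= \int[P]_w f (U w) + eta.
Proof.
move=> fa; rewrite prob_Rintegral; last exact: measurable_sublevel.
rewrite -[X in _ <= _ + X](Rintegral_probability_cst P) -RintegralD//.
apply: le_Rintegral => //.
- exact/indic_integrable/measurable_sublevel.
- exact: integrable_realD.
- move=> w _; rewrite indicE; have [/set_mem /= h|_] := boolP (w \in _).
    by have := fa _ h; rewrite lerBlDr.
  by rewrite addr_ge0// ltW.
Qed.

Lemma step_le_prob : (forall y, b < y -> f y <= eta) ->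
  \int[P]_w f (U w) <= fine (P [set w | U w <= b]) + eta.
Proof.
move=> fb; rewrite prob_Rintegral; last exact: measurable_sublevel.
have i1 := indic_integrable (measurable_sublevel b).
rewrite -[X in _ <= _ + X](Rintegral_probability_cst P) -RintegralD//.
apply: le_Rintegral => //.
- exact: integrable_realD.
- move=> w _; rewrite indicE; have [_|/negP h] := boolP (w \in _).
    by apply: le_trans (f1 _) _; rewrite lerDl ltW.
  by rewrite add0r; apply: fb; rewrite ltNge; apply/negP => Ub; apply: h; exact: mem_set.
Qed.

End one_variable.

Section clt_cdf.
Context d (T : measurableType d) (P : probability T R).
Variables (e : nat -> T -> R) (s2 : R).
Hypothesis me : forall i, measurable_fun setT (e i).
Hypothesis ie : forall i, P.-integrable setT (EFin \o (fun w => e i w ^+ 2)).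
Hypothesis Ee : forall i, \int[P]_w e i w = 0.
Hypothesis Ve : \int[P]_w (e 0%N w ^+ 2) = s2.
Hypothesis inde : mutually_independent P e.
Hypothesis lawe : forall i, same_law P (e i) (e 0%N).
Variables (c : nat -> nat -> R) (m : nat -> R) (v : R).
Hypothesis cv : (fun n => \sum_(i < n) c n i ^+ 2) @ \oo --> v.
Hypothesis m0 : m @ \oo --> (0 : R).
Hypothesis cm : forall n i, (i < n)%N -> `|c n i| <= m n.
Hypothesis v0 : 0 <= v.

Let S n (w : T) := \sum_(i < n) c n i * e i w.

Lemma measurable_weighted_sum n : measurable_fun setT (S n).
Proof. by apply: measurable_sum => i; exact: measurable_funM. Qed.

Let s20 : 0 <= s2.
Proof. by rewrite -Ve; apply: Rintegral_ge0 => w _; exact: sqr_ge0. Qed.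

(** Shifting the argument by [dl] makes room for a smooth step, and no continuity of the limit is
    required, so the statement also holds for a degenerate limit. *)
Lemma weighted_clt_cdf (x dl eta : R) : 0 < dl -> 0 < eta ->
  \forall n \near \oo,
    normal_cdf (s2 * v) (x - dl) - eta <= fine (P [set w | S n w <= x]) <=
    normal_cdf (s2 * v) (x + dl) + eta.
Proof.
(* One third of [eta] for the step against the law of [S n], one for the convergence, and one for
   the step against the Gaussian. *)
move=> dl0 eta0; have e3 : 0 < eta / 3 by rewrite divr_gt0.
have mlin : measurable_fun [set: R] (fun y : R => Num.sqrt (s2 * v) * y).
  exact: measurable_funM.
have [B [f [f1 [f2 [sf fle fa fb]]]]] := @smooth_step R x (x + dl) _ ltac:(lra) e3.
have [B' [g [g1 [g2 [sg gle ga gb]]]]] := @smooth_step R (x - dl) x _ ltac:(lra) e3.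
have [f0 bf _ _ _] := sf; have [g0 bg _ _ _] := sg.
have Cf := weighted_clt me ie Ee Ve inde lawe cv m0 cm sf.
have Cg := weighted_clt me ie Ee Ve inde lawe cv m0 cm sg.
have GE k : gauss_average (Num.sqrt (s2 * v)) k 0 =
    \int[gauss]_y k (Num.sqrt (s2 * v) * y).
  by apply: eq_Rintegral => y _; rewrite add0r.
near=> n; have mS := measurable_weighted_sum n.
rewrite !normal_cdfE ?mulr_ge0//; apply/andP; split.
- have h1 := prob_le_step gauss mlin bg g0 e3 ga.
  have h2 := step_le_prob P mS bg gle e3 gb.
  have h3 : `|gauss_average (Num.sqrt (s2 * v)) g 0 - \int[P]_w g (S n w)| <= eta / 3.
    by near: n; move/cvgrPdist_le : Cg; exact.
  by rewrite GE ler_norml in h3; move: h3 => /andP[h3 h4]; lra.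
- have h1 := prob_le_step P mS bf f0 e3 fa.
  have h2 := step_le_prob gauss mlin bf fle e3 fb.
  have h3 : `|gauss_average (Num.sqrt (s2 * v)) f 0 - \int[P]_w f (S n w)| <= eta / 3.
    by near: n; move/cvgrPdist_le : Cf; exact.
  by rewrite GE ler_norml in h3; move: h3 => /andP[h3 h4]; lra.
Unshelve. all: end_near. Qed.

End clt_cdf.
End cdf_bounds.

(** * Centered instruments and negligibility of the weights *)

Section instruments.
Context {R : realType}.
Variable Z : nat -> R.

Definition centered n i : R := Z i - smean n Z.

Lemma sum_centered n : (0 < n)%N -> \sum_(i < n) centered n i = 0.
Proof.
move=> n0; rewrite /centered sumrB sumr_const card_ord -[smean n Z *+ n]mulr_natr /smean.
by rewrite divfK ?subrr// pnatr_eq0 -lt0n.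
Qed.

Lemma sum_mul_centered n (u : nat -> R) : (0 < n)%N ->
  \sum_(i < n) (u i - smean n u) * centered n i = \sum_(i < n) u i * centered n i.
Proof.
move=> n0; under eq_bigr do rewrite mulrBl.
by rewrite sumrB -mulr_sumr sum_centered// mulr0 subr0.
Qed.

Lemma sum_sqr_centered n : (0 < n)%N ->
  \sum_(i < n) centered n i ^+ 2 = \sum_(i < n) Z i * centered n i.
Proof.
by move=> n0; rewrite -sum_mul_centered//; apply: eq_bigr => i _.
Qed.

Hypothesis Z2 : (fun n => (\sum_(i < n) Z i ^+ 2) / n%:R) @ \oo --> (1 : R).
Hypothesis Z1 : (fun n => smean n Z) @ \oo --> (0 : R).

Lemma cvg_mean_sqr_centered :
  (fun n => (\sum_(i < n) centered n i ^+ 2) / n%:R) @ \oo --> (1 : R).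
Proof.
have h : (fun n => (\sum_(i < n) Z i ^+ 2) / n%:R - smean n Z ^+ 2) @ \oo --> (1 : R).
  rewrite [X in _ --> X](_ : 1 = 1 - 0 ^+ 2); last by rewrite expr0n subr0.
  by apply: cvgB => //; exact: cvgM.
apply: cvg_trans h; apply: near_eq_cvg; near=> n.
have n0 : (0 < n)%N by near: n; exact: nbhs_infty_gt.
have nN0 : n%:R != 0 :> R by rewrite pnatr_eq0 -lt0n.
rewrite sum_sqr_centered// /centered.
under [in RHS]eq_bigr do rewrite mulrBr -expr2.
by rewrite sumrB -mulr_suml mulrBl [X in _ = _ - X]mulrAC expr2.
Unshelve. all: end_near. Qed.

(** With [t n] the mean of the first [n] squares, the quantity is [t n.+1 - t n * (n / n.+1)], a
    difference of two sequences tending to 1. *)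
Lemma cvg_sqr_div : (fun n => Z n ^+ 2 / n.+1%:R) @ \oo --> (0 : R).
Proof.
pose t n := (\sum_(i < n) Z i ^+ 2) / n%:R.
have tS : (fun n => t n.+1) @ \oo --> (1 : R) by rewrite (cvg_shiftS t).
have th : (fun n => t n * (1 - n.+1%:R^-1)) @ \oo --> (1 : R).
  rewrite [X in _ --> X](_ : 1 = 1 * (1 - 0)); last by rewrite subr0 mulr1.
  apply: cvgM => //; apply: cvgB; [exact: cvg_cst|exact: cvg_harmonic].
have h : (fun n => t n.+1 - t n * (1 - n.+1%:R^-1)) @ \oo --> (0 : R).
  by rewrite -[X in _ --> X](subrr (1 : R)); exact: cvgB.
apply: cvg_trans h; apply: near_eq_cvg; near=> n.
have n0 : (0 < n)%N by near: n; exact: nbhs_infty_gt.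
have nN0 : n%:R != 0 :> R by rewrite pnatr_eq0 -lt0n.
have nS0 : n%:R + 1 != 0 :> R by rewrite natr1 pnatr_eq0.
by rewrite /t big_ord_recr /= -natr1; field; rewrite nN0 nS0.
Unshelve. all: end_near. Qed.

(** From a rank [N] on, each square is at most [a ^+ 2 * i.+1]; the finitely many earlier ones are
    bounded by the constant [C], which [a ^+ 2 * n] eventually exceeds. *)
Lemma instrument_negligible (a : R) : 0 < a ->
  \forall n \near \oo, forall i, (i < n)%N -> `|Z i| <= a * Num.sqrt n%:R.
Proof.
move=> a0; have a20 : 0 < a ^+ 2 by rewrite exprn_gt0.
have /cvgrPdist_le /(_ _ a20) [N _ hN] := cvg_sqr_div.
pose C := \sum_(i < N) Z i ^+ 2.
near=> n => i ni.
suff h : Z i ^+ 2 <= a ^+ 2 * n%:R.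
  have s0 : 0 <= a * Num.sqrt n%:R by rewrite mulr_ge0 ?sqrtr_ge0// ltW.
  by rewrite -(@ler_pXn2r _ 2) ?nnegrE// real_normK ?num_real// exprMn sqr_sqrtr.
have [Ni|iN] := leqP N i.
  have := hN i Ni; rewrite /= sub0r normrN ger0_norm ?divr_ge0 ?sqr_ge0//.
  rewrite ler_pdivrMr ?ltr0Sn// => /le_trans; apply.
  by rewrite ler_pM2l// ler_nat.
apply: (@le_trans _ _ C).
  rewrite /C (bigD1 (Ordinal iN))//= lerDl; apply: sumr_ge0 => j _; exact: sqr_ge0.
rewrite -ler_pdivrMl//; near: n.
exact: nbhs_infty_ger.
Unshelve. all: end_near. Qed.

Lemma centered_negligible (a : R) : 0 < a ->
  \forall n \near \oo, forall i, (i < n)%N ->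
    `|centered n i| <= a * Num.sqrt n%:R.
Proof.
move=> a0; have a2 : 0 < a / 2 by rewrite divr_gt0.
near=> n => i ni.
have n1 : 1 <= Num.sqrt n%:R :> R.
  rewrite -[leLHS]sqrtr1; apply: ler_wsqrtr.
  by rewrite ler1n; exact: leq_trans ni.
have h1 : `|Z i| <= a / 2 * Num.sqrt n%:R.
  by move: i ni; near: n; exact: instrument_negligible.
have h2 : `|smean n Z| <= a / 2.
  near: n; move/cvgrPdist_le : Z1 => /(_ _ a2).
  by apply: filterS => n; rewrite sub0r normrN.
apply: le_trans (ler_normB _ _) _.
have : a / 2 <= a / 2 * Num.sqrt n%:R by rewrite ler_peMr// ltW.
lra.
Unshelve. all: end_near. Qed.

(** Supplies the sequence [m] of weight bounds needed by the limit theorem. *)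
Lemma bigmax_cvg0 (c : nat -> nat -> R) :
  (forall a, 0 < a -> \forall n \near \oo, forall i, (i < n)%N -> `|c n i| <= a) ->
  (fun n => \big[Num.max/0]_(i < n) `|c n i|) @ \oo --> (0 : R).
Proof.
move=> ch; apply/cvgrPdist_le => a a0; have := ch a a0; apply: filterS => n cn.
rewrite sub0r normrN ger0_norm; last first.
  by elim/big_ind : _ => // x y x0 y0; rewrite le_max x0.
by apply: bigmax_le; [exact: ltW|move=> i _; exact: cn].
Qed.

End instruments.

Lemma measurable_funV_real d (T : measurableType d) (R : realType) (u : T -> R) :
  measurable_fun setT u -> measurable_fun setT (fun w => (u w)^-1).
Proof.
move=> mu; apply: (@measurableT_comp _ _ _ _ _ _ (fun x : R => x^-1)) => //.
(* Inversion is continuous only off 0; a singleton is measurable for any function, whatever the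
   value at 0. *)
have -> : [set: R] = [set 0] `|` ~` [set 0] by rewrite setUv.
apply/measurable_funU => //; first exact: measurableC.
split; first exact: measurable_fun_set1.
apply: open_continuous_measurable_fun.
  exact/closed_openC/accessible_closed_set1/hausdorff_accessible.
move=> x; rewrite inE /= => /eqP x0; exact: inv_continuous.
Qed.

Lemma probability_le_setU d (T : measurableType d) (R : realType)
    (P : probability T R) (A B C : set T) :
  measurable A -> measurable B -> measurable C -> A `<=` B `|` C ->
  fine (P A) <= fine (P B) + fine (P C).
Proof.
move=> mA mB mC ABC.
have fin (E : set T) : measurable E -> P E \is a fin_num by move=> mE; exact: fin_num_measure.
rewrite -fineD ?fin//; apply: fine_le; rewrite ?fin_numD ?fin//.
apply: (@le_trans _ _ (P (B `|` C))); last exact: measureU2.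
by apply: le_measure => //; rewrite inE//; exact: measurableU.
Qed.

(* Dividing through by [pi1] makes the normalised denominator [b] tend to 1, so
   that the comparison of the ratio with [x] becomes an additive one. *)
Lemma ridge_error_le (R : realType) (n : nat) (Y D Z eps eta : nat -> R)
    (beta0 beta1 pi0 pi1 lam x : R) : (0 < n)%N -> pi1 != 0 ->
  (forall i, Y i = beta0 + beta1 * D i + eps i) ->
  (forall i, D i = pi0 + pi1 * Z i + eta i) ->
  let b := (\sum_(i < n) centered Z n i ^+ 2) / n%:R +
           \sum_(i < n) centered Z n i / (n%:R * pi1) * eta i +
           lam / Num.sqrt n%:R / (Num.sqrt n%:R * pi1) in
  0 < b ->
  (Num.sqrt n%:R * (beta_ridge n lam Y D Z - beta1) <= x) =
  (\sum_(i < n) centered Z n i / (Num.sqrt n%:R * pi1) * eps i <=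
   beta1 * (lam / Num.sqrt n%:R) / pi1 + x * b).
Proof.
move=> n0 p0 YE DE b b0.
set s := Num.sqrt n%:R.
have s0 : s != 0 by rewrite gt_eqF// sqrtr_gt0 ltr0n.
have s2 : s * s = n%:R by rewrite -expr2 sqr_sqrtr.
pose q := \sum_(i < n) centered Z n i ^+ 2.
pose W := \sum_(i < n) eps i * centered Z n i.
pose V := \sum_(i < n) eta i * centered Z n i.
have cst0 (k : R) : \sum_(i < n) k * centered Z n i = 0.
  by rewrite -mulr_sumr sum_centered// mulr0.
have DS : \sum_(i < n) (D i - smean n D) * (Z i - smean n Z) = pi1 * q + V.
  rewrite sum_mul_centered//.
  under eq_bigr do rewrite DE !mulrDl -(mulrA pi1).
  by rewrite !big_split /= cst0 add0r -mulr_sumr -sum_sqr_centered.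
have YS : \sum_(i < n) (Y i - smean n Y) * (Z i - smean n Z) =
    beta1 * (pi1 * q + V) + W.
  rewrite sum_mul_centered// -DS sum_mul_centered//.
  under eq_bigr do rewrite YE !mulrDl -(mulrA beta1).
  by rewrite !big_split /= cst0 add0r -mulr_sumr.
have wE (k : R) (u : nat -> R) : \sum_(i < n) centered Z n i / k * u i =
    (\sum_(i < n) u i * centered Z n i) / k.
  by rewrite mulr_suml; apply: eq_bigr => i _; ring.
have bE : pi1 * q + V + lam = s * s * pi1 * b.
  rewrite /b wE -/V -/q -/s -s2; field.
  by rewrite s0 p0.
(* Only the positive [b] is divided out of the inequality; [pi1], of either sign, stays inside the
   weights, so the inequality is never reversed. *)
rewrite /beta_ridge YS DS bE wE -/W -lerBlDl -ler_pdivrMr//.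
congr (_ <= x).
have b0' : b != 0 by rewrite gt_eqF.
have -> : beta1 * (pi1 * q + V) = beta1 * (s * s * pi1 * b - lam) by rewrite -bE addrK.
by field; rewrite s0 p0 b0'.
Qed.

(** * Marginal properties of the error pairs *)

Section errors.
Context d (T : measurableType d) (R : realType) (P : probability T R).

Lemma expectation0_Rintegral (u : T -> R) : ('E_P[u] = 0)%E -> \int[P]_w u w = 0.
Proof. by rewrite unlock /Rintegral => ->. Qed.

Lemma variance_Rintegral (u : T -> R) (s2 : R) : u \in Lfun P 2%:E ->
  ('E_P[u] = 0)%E -> 'V_P[u] = s2%:E -> \int[P]_w (u w ^+ 2) = s2.
Proof.
move=> u2 Eu; rewrite varianceE// Eu expe2 mule0 sube0 unlock => h.
by rewrite /Rintegral (_ : (\int[P]_w (u w ^+ 2)%:E)%E = s2%:E).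
Qed.

Lemma Lfun2_measurable (u : T -> R) : u \in Lfun P 2%:E -> measurable_fun setT u.
Proof. by move=> /sub_Lfun_mfun; rewrite inE. Qed.

Variables (eps eta : nat -> T -> R).
Let pairs i w := (eps i w, eta i w).

Lemma mutually_independent_fst : mutually_independent_pairs P pairs ->
  mutually_independent P eps.
Proof.
move=> h J A uJ mA.
have := h J (fun i => A i `*` setT) uJ.
rewrite (_ : [set w | _] = [set w | forall i, i \in J -> A i (eps i w)]); last first.
  by apply/seteqP; split => w /= hw i iJ; [have [] := hw i iJ|split => //; exact: hw].
rewrite (eq_bigr (fun i => P (eps i @^-1` A i))); last first.
  by move=> i _; congr (P _); apply/seteqP; split => w //= [].
by apply => i iJ; apply: measurableX => //; exact: mA.
Qed.

Lemma mutually_independent_snd : mutually_independent_pairs P pairs ->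
  mutually_independent P eta.
Proof.
move=> h J A uJ mA.
have := h J (fun i => setT `*` A i) uJ.
rewrite (_ : [set w | _] = [set w | forall i, i \in J -> A i (eta i w)]); last first.
  by apply/seteqP; split => w /= hw i iJ; [have [] := hw i iJ|split => //; exact: hw].
rewrite (eq_bigr (fun i => P (eta i @^-1` A i))); last first.
  by move=> i _; congr (P _); apply/seteqP; split => w //= [].
by apply => i iJ; apply: measurableX => //; exact: mA.
Qed.

Lemma same_law_fst : identically_distributed_pairs P pairs ->
  forall i, same_law P (eps i) (eps 0%N).
Proof.
move=> h i A mA; have := h i (A `*` setT).
have E j : pairs j @^-1` (A `*` setT) = eps j @^-1` A.
  by apply/seteqP; split => w //= [].
by rewrite !E; apply; exact: measurableX.
Qed.

Lemma same_law_snd : identically_distributed_pairs P pairs ->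
  forall i, same_law P (eta i) (eta 0%N).
Proof.
move=> h i A mA; have := h i (setT `*` A).
have E j : pairs j @^-1` (setT `*` A) = eta j @^-1` A.
  by apply/seteqP; split => w //= [].
by rewrite !E; apply; exact: measurableX.
Qed.

End errors.

(** * Negligible sums and the limit law of the ridge estimator *)

Lemma measurable_norm_gt (R : realType) d (T : measurableType d) (U : T -> R) (r : R) :
  measurable_fun setT U -> measurable [set w | r < `|U w|].
Proof.
move=> mU.
have mN : measurable_fun setT (fun w => `|U w|) by exact: measurableT_comp.
rewrite (_ : [set w | _] = ~` [set w | `|U w| <= r]).
  exact/measurableC/measurable_sublevel.
by apply/seteqP; split => w /=; [rewrite ltNge => /negP|move/negP; rewrite -ltNge].
Qed.

(* The degenerate case [v = 0] of the CLT plays the role of Chebyshev's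
   inequality. *)
Lemma weighted_sum_negligible (R : realType) d (T : measurableType d)
    (P : probability T R) (e : nat -> T -> R) (c : nat -> nat -> R) (m : nat -> R) :
  (forall i, measurable_fun setT (e i)) ->
  (forall i, P.-integrable setT (EFin \o (fun w => e i w ^+ 2))) ->
  (forall i, \int[P]_w e i w = 0) ->
  mutually_independent P e -> (forall i, same_law P (e i) (e 0%N)) ->
  (fun n => \sum_(i < n) c n i ^+ 2) @ \oo --> (0 : R) ->
  m @ \oo --> (0 : R) -> (forall n i, (i < n)%N -> `|c n i| <= m n) ->
  forall r a : R, 0 < r -> 0 < a ->
  \forall n \near \oo, fine (P [set w | r < `|\sum_(i < n) c n i * e i w|]) <= a.
Proof.
move=> me ie Ee inde lawe cv m0 cm r a r0 a0.
have a2 : 0 < a / 2 by rewrite divr_gt0.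
have r2 : 0 < r / 2 by rewrite divr_gt0.
have cdf0 (s y : R) : normal_cdf (s * 0) y = if 0 <= y then 1 else 0.
  by rewrite mulr0 /normal_cdf eqxx.
pose s2 := \int[P]_w (e 0%N w ^+ 2).
(* Used at [r] and [- r] with shift [r / 2]: the limit is evaluated at [r / 2] and [- (r / 2)],
   where the step function is 1 and 0, so each tail costs at most [a / 2]. *)
have C x := weighted_clt_cdf me ie Ee (erefl s2) inde lawe cv m0 cm (lexx 0) x r2 a2.
near=> n.
have h1 : normal_cdf (s2 * 0) (r - r / 2) - a / 2 <=
    fine (P [set w | \sum_(i < n) c n i * e i w <= r]) <=
    normal_cdf (s2 * 0) (r + r / 2) + a / 2 by near: n; exact: (C r).
have h2 : normal_cdf (s2 * 0) (- r - r / 2) - a / 2 <=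
    fine (P [set w | \sum_(i < n) c n i * e i w <= - r]) <=
    normal_cdf (s2 * 0) (- r + r / 2) + a / 2 by near: n; exact: (C (- r)).
pose S w := \sum_(i < n) c n i * e i w.
have mS : measurable_fun setT S by apply: measurable_sum => i; exact: measurable_funM.
have ml b := measurable_sublevel mS b.
have mgt := measurable_norm_gt r mS.
have sub : [set w | r < `|S w|] `<=` [set w | S w <= - r] `|` ~` [set w | S w <= r].
  move=> w /=; rewrite lter_normr => /orP[h|h]; [right|left].
    by apply/negP; rewrite -ltNge.
  by rewrite lerNr ltW.
apply: le_trans (probability_le_setU P mgt (ml _) (measurableC (ml _)) sub) _.
rewrite probability_setC// fineB//; last exact: fin_num_measure.
move: h1 h2; rewrite !cdf0 -/S.
have -> : 0 <= r - r / 2 by lra.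
have -> : (0 <= - r + r / 2) = false by apply/negbTE; rewrite -ltNge; lra.
move=> /andP[h1 _] /andP[_ h2].
rewrite /=; lra.
Unshelve. all: end_near. Qed.

Theorem mainTheorem2 (R : realType) (d : measure_display)
  (T : measurableType d) (P : probability T R)
  (eps eta : nat -> T -> R) (Y D : nat -> T -> R) (Z : nat -> R)
  (beta0 beta1 pi0 pi1 sigma2_eps : R) (lambda : nat -> R) :
  (* errors: i.i.d. pairs, mean zero, finite variances (possibly correlated) *)
  (forall i, eps i \in Lfun P 2%:E) ->
  (forall i, eta i \in Lfun P 2%:E) ->
  mutually_independent_pairs P (fun i w => (eps i w, eta i w)) ->
  identically_distributed_pairs P (fun i w => (eps i w, eta i w)) ->
  (forall i, ('E_P[eps i] = 0)%E) ->
  (forall i, ('E_P[eta i] = 0)%E) ->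
  'V_P[eps 0%N] = sigma2_eps%:E ->
  (* the model *)
  (forall i w, Y i w = beta0 + beta1 * D i w + eps i w) ->
  (forall i w, D i w = pi0 + pi1 * Z i + eta i w) ->
  pi1 != 0 ->
  (* Assumption A: deterministic instruments *)
  (fun n => (\sum_(i < n) Z i ^+ 2) / n%:R) @ \oo --> (1 : R) ->
  (fun n => smean n Z) @ \oo --> (0 : R) ->
  (* penalty: nonnegative, lambda_n = o(sqrt n) *)
  (forall n, 0 <= lambda n) ->
  (fun n => lambda n / Num.sqrt n%:R) @ \oo --> (0 : R) ->
  cvg_in_distribution P
    (fun n w => Num.sqrt n%:R *
       (beta_ridge n (lambda n) (fun i => Y i w) (fun i => D i w) Z - beta1))
    (normal_cdf (sigma2_eps / pi1 ^+ 2)).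
Proof.
move=> eps2 eta2 ind idd Eeps Eeta Veps YE DE p0 Z2 Z1 lam0 lamo x Fx.
have me i := Lfun2_measurable (eps2 i); have mt i := Lfun2_measurable (eta2 i).
have ie i := Lfun2_integrable_sqr (eps2 i); have it i := Lfun2_integrable_sqr (eta2 i).
have Ee i := expectation0_Rintegral (Eeps i); have Et i := expectation0_Rintegral (Eeta i).
have Ve := variance_Rintegral (eps2 0%N) (Eeps 0%N) Veps.
have inde := mutually_independent_fst ind; have indt := mutually_independent_snd ind.
have lawe := same_law_fst idd; have lawt := same_law_snd idd.
(* [ce] weights the [eps i] of the numerator; [ct], smaller by a factor [sqrt n], weights the
   [eta i] of the normalised denominator, so its squares sum to 0 in the limit. *)
pose ce n i := centered Z n i / (Num.sqrt n%:R * pi1).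
pose ct n i := centered Z n i / (n%:R * pi1).
pose q n := (\sum_(i < n) centered Z n i ^+ 2) / n%:R.
have q1 : q @ \oo --> (1 : R) := cvg_mean_sqr_centered Z2 Z1.
have ap0 : 0 < `|pi1| by rewrite normr_gt0.
have sqn0 n : (0 < n)%N -> 0 < Num.sqrt n%:R :> R by move=> n0; rewrite sqrtr_gt0 ltr0n.
have sqn1 n : (0 < n)%N -> 1 <= Num.sqrt n%:R :> R.
  by move=> n0; rewrite -[leLHS]sqrtr1; apply: ler_wsqrtr; rewrite ler1n.
have invn : (fun n => n%:R^-1) @ \oo --> (0 : R).
  by rewrite -(cvg_shiftS (fun n => n%:R^-1 : R)); exact: cvg_harmonic.
have ce2 : (fun n => \sum_(i < n) ce n i ^+ 2) @ \oo --> pi1 ^- 2.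
  have h : (fun n => q n * pi1 ^- 2) @ \oo --> pi1 ^- 2.
    by rewrite -[X in _ --> X]mul1r; exact: cvgMr_tmp.
  apply: cvg_trans h; apply: near_eq_cvg; near=> n.
  rewrite /q !mulr_suml; apply: eq_bigr => i _.
  by rewrite /ce expr_div_n exprMn sqr_sqrtr// [in RHS]invfM mulrA.
have ct2 : (fun n => \sum_(i < n) ct n i ^+ 2) @ \oo --> (0 : R).
  have h : (fun n => q n * n%:R^-1 * pi1 ^- 2) @ \oo --> (0 : R).
    rewrite [X in _ --> X](_ : 0 = 1 * 0 * pi1 ^- 2); last by rewrite mulr0 mul0r.
    by apply: cvgMr_tmp; exact: cvgM.
  apply: cvg_trans h; apply: near_eq_cvg; near=> n.
  rewrite /q !mulr_suml; apply: eq_bigr => i _.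
  by rewrite /ct expr_div_n exprMn [in RHS]invfM -!exprVn; ring.
have ce_small (a : R) : 0 < a ->
    \forall n \near \oo, forall i, (i < n)%N -> `|ce n i| <= a.
  move=> a0; have ap : 0 < a * `|pi1| by rewrite mulr_gt0.
  have := centered_negligible Z2 Z1 ap; apply: filterS => n h i ni.
  have n0 : (0 < n)%N by exact: leq_trans ni.
  rewrite /ce normrM normfV normrM (gtr0_norm (sqn0 _ n0)).
  by rewrite ler_pdivrMr ?mulr_gt0 ?sqn0// (mulrC _ `|pi1|) mulrA h.
have ct_small (a : R) : 0 < a ->
    \forall n \near \oo, forall i, (i < n)%N -> `|ct n i| <= a.
  move=> a0; have := ce_small a a0; apply: filterS => n h i ni.
  have n0 : (0 < n)%N by exact: leq_trans ni.
  have s1 := sqn0 n n0; have nn : 0 < n%:R :> R by rewrite ltr0n.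
  apply: le_trans (h i ni); rewrite /ct /ce !(normrM, normfV) ler_wpM2l//.
  rewrite (gtr0_norm s1) (gtr0_norm nn) lef_pV2 ?posrE ?mulr_gt0// ler_pM2r//.
  by rewrite -[leRHS]sqr_sqrtr// expr2 ler_peMr ?sqrtr_ge0// sqn1.
have maxe := bigmax_cvg0 ce_small; have maxt := bigmax_cvg0 ct_small.
have lee n i : (i < n)%N -> `|ce n i| <= \big[Num.max/0]_(j < n) `|ce n j|.
  by move=> ni; exact: (le_bigmax _ (fun j : 'I_n => `|ce n j|) (Ordinal ni)).
have let_ n i : (i < n)%N -> `|ct n i| <= \big[Num.max/0]_(j < n) `|ct n j|.
  by move=> ni; exact: (le_bigmax _ (fun j : 'I_n => `|ct n j|) (Ordinal ni)).
have v0 : 0 <= pi1 ^- 2 by rewrite invr_ge0 sqr_ge0.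
have CLT := weighted_clt_cdf me ie Ee Ve inde lawe ce2 maxe lee v0.
have NEG := weighted_sum_negligible mt it Et indt lawt ct2 maxt let_.
(* Here [y], [yp], [ym] stand for the limit at [x] and at [x] shifted by [2 * dl] either way, [p]
   for the probability under study, [pp] and [pm] for those of the weighted sum at [x + dl] and
   [x - dl], and [b] for the exceptional event. *)
have sandwich (a y yp ym p pp pm b : R) : - (a / 4) <= y - yp -> y - ym <= a / 4 ->
    b <= a / 4 -> pp <= yp + a / 4 -> ym - a / 4 <= pm -> p <= pp + b ->
    pm <= p + b -> - a <= y - p <= a.
  by move=> *; apply/andP; split; lra.
apply/cvgrPdist_le => a a0; have a4 : 0 < a / 4 by rewrite divr_gt0.
have /cvgrPdist_le /(_ _ a4) [dl0 /= dl0_gt0 Fnear] := Fx.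
(* The limit is evaluated at distance [2 * dl = dl0 / 2] from [x], strictly inside the ball given by
   continuity. *)
pose dl := dl0 / 4; have dl_gt0 : 0 < dl by rewrite divr_gt0.
(* [6^-1] keeps the normalised denominator at least [1 - 3 * r >= 1 / 2]; the other bound makes the
   threshold move by at most [r + |x| * (3 * r) <= dl]. *)
pose r := Num.min 6^-1 (dl / (1 + 3 * `|x|)).
have x3 : 0 < 1 + 3 * `|x| by have := normr_ge0 x; lra.
have r0 : 0 < r by rewrite lt_min invr_gt0 ltr0n divr_gt0.
have r6 : r <= 6^-1 by rewrite ge_min lexx.
have rx : r * (1 + 3 * `|x|) <= dl by rewrite -ler_pdivlMr// ge_min lexx orbT.
have lam1 : (fun n => beta1 * (lambda n / Num.sqrt n%:R) / pi1) @ \oo --> (0 : R).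
  rewrite [X in _ --> X](_ : 0 = beta1 * 0 / pi1); last by rewrite mulr0 mul0r.
  by apply: cvgMr_tmp; exact: cvgMl_tmp.
have lam2 : (fun n => lambda n / Num.sqrt n%:R / pi1) @ \oo --> (0 : R).
  by rewrite -[X in _ --> X](mul0r pi1^-1); exact: cvgMr_tmp.
have mS (c : nat -> R) (u : nat -> T -> R) n : (forall i, measurable_fun setT (u i)) ->
    measurable_fun setT (fun w => \sum_(i < n) c i * u i w).
  by move=> mu; apply: measurable_sum => i; exact: measurable_funM.
near=> n.
have n0 : (0 < n)%N by near: n; exact: nbhs_infty_gt.
pose W w := \sum_(i < n) ce n i * eps i w.
pose V w := \sum_(i < n) ct n i * eta i w.
pose X w := Num.sqrt n%:R *
  (beta_ridge n (lambda n) (fun i => Y i w) (fun i => D i w) Z - beta1).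
have mW : measurable_fun setT W by exact: mS.
have mV : measurable_fun setT V by exact: mS.
have mD i : measurable_fun setT (D i).
  rewrite (_ : D i = (fun w => pi0 + pi1 * Z i + eta i w)); last exact/funext/DE.
  exact: measurable_funD.
have mY i : measurable_fun setT (Y i).
  rewrite (_ : Y i = (fun w => beta0 + beta1 * D i w + eps i w)); last exact/funext/YE.
  by apply: measurable_funD => //; apply: measurable_funD => //; exact: measurable_funM.
have mnum (U : nat -> T -> R) : (forall i, measurable_fun setT (U i)) ->
    measurable_fun setT (fun w => \sum_(i < n)
      (U i w - smean n (fun i => U i w)) * (Z i - smean n Z)).
  move=> mU; apply: measurable_sum => i; apply: measurable_funM => //.
  apply: measurable_funB => //; apply: measurable_funM => //.
  exact: measurable_sum.
have mX : measurable_fun setT X.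
  apply: measurable_funM => //; apply: measurable_funB => //.
  apply: measurable_funM; first exact: mnum.
  by apply: measurable_funV_real; apply: measurable_funD => //; exact: mnum.
have mbad := measurable_norm_gt r mV.
have qr : `|1 - q n| <= r by near: n; move/cvgrPdist_le : q1; exact.
have l1 : `|beta1 * (lambda n / Num.sqrt n%:R) / pi1| <= r.
  near: n; move/cvgrPdist_le : lam1 => /(_ _ r0).
  by apply: filterS => n; rewrite sub0r normrN.
have l2 : `|lambda n / Num.sqrt n%:R / (Num.sqrt n%:R * pi1)| <= r.
  have : `|lambda n / Num.sqrt n%:R / pi1| <= r.
    near: n; move/cvgrPdist_le : lam2 => /(_ _ r0).
    by apply: filterS => n; rewrite sub0r normrN.
  apply: le_trans; rewrite invfM mulrCA normrM ler_piMl// normfV.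
  by rewrite ger0_norm ?sqrtr_ge0// invf_le1 ?sqn0// sqn1.
(* The threshold [t] depends on [w], so it is enclosed between [x - dl] and [x + dl], which gives
   inclusions of events up to the exceptional one. *)
have event w : `|V w| <= r -> exists2 t, `|t - x| <= dl & (X w <= x) = (W w <= t).
  move=> Vr; set k := lambda n / Num.sqrt n%:R / (Num.sqrt n%:R * pi1) in l2.
  set rho := beta1 * _ / pi1 in l1.
  have b0 : 0 < q n + V w + k.
    move: qr Vr l2; rewrite !ler_norml => /andP[_ h1] /andP[h2 _] /andP[h3 _]; lra.
  exists (rho + x * (q n + V w + k)); last first.
    exact: (@ridge_error_le R n (fun i => Y i w) (fun i => D i w) Z
      (fun i => eps i w) (fun i => eta i w) beta0 beta1 pi0 pi1 (lambda n) x n0 p0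
      (fun i => YE i w) (fun i => DE i w) b0).
  rewrite (_ : _ - x = rho + x * (q n - 1 + V w + k)); last by ring.
  apply: le_trans (ler_normD _ _) _; rewrite (normrM x).
  have h3 : `|q n - 1 + V w + k| <= 3 * r.
    apply: le_trans (ler_normD _ _) _; have := ler_normD (q n - 1) (V w).
    by rewrite distrC in qr; lra.
  have := ler_wpM2l (normr_ge0 x) h3; lra.
have sub1 : [set w | X w <= x] `<=` [set w | W w <= x + dl] `|` [set w | r < `|V w|].
  move=> w /= Xx; have [Vr|] := leP `|V w| r; last by right.
  left; have [t tx e] := event w Vr; rewrite e in Xx.
  by move: tx; rewrite ler_norml => /andP[_ h]; lra.
have sub2 : [set w | W w <= x - dl] `<=` [set w | X w <= x] `|` [set w | r < `|V w|].
  move=> w /= Wx; have [Vr|] := leP `|V w| r; last by right.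
  left; have [t tx e] := event w Vr; rewrite e.
  by move: tx; rewrite ler_norml => /andP[h _]; lra.
have ml := fun (U : T -> R) (mU : measurable_fun setT U) b => measurable_sublevel mU b.
have P1 := probability_le_setU P (ml _ mX x) (ml _ mW _) mbad sub1.
have P2 := probability_le_setU P (ml _ mW _) (ml _ mX x) mbad sub2.
have Pbad : fine (P [set w | r < `|\sum_(i < n) ct n i * eta i w|]) <= a / 4.
  by near: n; exact: (NEG r (a / 4)).
(* The CLT bound shifts by a further [dl], so from each use only the half facing away from [x] is
   kept. *)
have /andP[_ C1] : normal_cdf (sigma2_eps * pi1 ^- 2) (x + dl - dl) - a / 4 <=
    fine (P [set w | \sum_(i < n) ce n i * eps i w <= x + dl]) <=
    normal_cdf (sigma2_eps * pi1 ^- 2) (x + dl + dl) + a / 4.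
  by near: n; exact: (CLT (x + dl)).
have /andP[C2 _] : normal_cdf (sigma2_eps * pi1 ^- 2) (x - dl - dl) - a / 4 <=
    fine (P [set w | \sum_(i < n) ce n i * eps i w <= x - dl]) <=
    normal_cdf (sigma2_eps * pi1 ^- 2) (x - dl + dl) + a / 4.
  by near: n; exact: (CLT (x - dl)).
have F1 : `|normal_cdf (sigma2_eps / pi1 ^+ 2) x -
    normal_cdf (sigma2_eps / pi1 ^+ 2) (x + dl + dl)| <= a / 4.
  apply: Fnear; rewrite /= (_ : _ - _ = - (dl0 / 2)); last by rewrite /dl; field.
  by rewrite normrN gtr0_norm ?divr_gt0// ltr_pdivrMr// ltr_pMr// ltr1n.
have F2 : `|normal_cdf (sigma2_eps / pi1 ^+ 2) x -
    normal_cdf (sigma2_eps / pi1 ^+ 2) (x - dl - dl)| <= a / 4.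
  apply: Fnear; rewrite /= (_ : _ - _ = dl0 / 2); last by rewrite /dl; field.
  by rewrite gtr0_norm ?divr_gt0// ltr_pdivrMr// ltr_pMr// ltr1n.
move: F1 F2; rewrite !ler_norml => /andP[F1 _] /andP[_ F2].
have {}Pbad : fine (P [set w | r < `|V w|]) <= a / 4 := Pbad.
have {}C1 : fine (P [set w | W w <= x + dl]) <=
  normal_cdf (sigma2_eps / pi1 ^+ 2) (x + dl + dl) + a / 4 := C1.
have {}C2 : normal_cdf (sigma2_eps / pi1 ^+ 2) (x - dl - dl) - a / 4 <=
  fine (P [set w | W w <= x - dl]) := C2.
suff : - a <= normal_cdf (sigma2_eps / pi1 ^+ 2) x -
  fine (P [set w | X w <= x]) <= a by [].
exact: sandwich F1 F2 Pbad C1 C2 P1 P2.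
Unshelve. all: end_near. Qed.
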